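(* Let $\mathcal B$ be a unital C*-algebra, let $\mathcal A\subseteq\mathcal B$ be a logmodular subalgebra, and let $\mathcal H$ be a Hilbert space. If $\rho:\mathcal A\to B(\mathcal H)$ is a unital homomorphism which is $R_2$-contractive and $C_2$-contractive, then there exists a positive linear map $\Phi:\mathcal B\to B(\mathcal H)$ extending $\rho$ and satisfying $\Phi(a^*a)\ge\rho(a)^*\rho(a)$ and $\Phi(aa^* )\ge\rho(a)\rho(a)^*$ for every $a\in\mathcal A$. Such a map is unique. Moreover, if $\Psi:\mathcal B\to B(\mathcal H)$ is any completely positive map extending $\rho$, then $\Psi=\Phi$.
   Context: For a unital C*-algebra $\mathcal B$ and a unital subalgebra $\mathcal A\subseteq\mathcal B$, $\mathcal A^{-1}$ denotes the set of elements of $\mathcal A$ that are invertible with inverse in $\mathcal A$, and $\mathcal B_+^{-1}$ denotes the set of positive invertible elements of $\mathcal B$. $\mathcal A$ is called logmodular in $\mathcal B$ if $\{a^*a : a\in\mathcal A^{-1}\}$ is (norm) dense in $\mathcal B_+^{-1}$. A linear map $\rho:\mathcal A\to B(\mathcal H)$ is $R_n$-contractive if $\|(\rho(a_1),\ldots,\rho(a_n))\|\le\|(a_1,\ldots,a_n)\|$ for all $a_1,\ldots,a_n\in\mathcal A$, where rows are normed as elements of $M_{1,n}(\mathcal B)$ and $B(\mathcal H^{(n)},\mathcal H)$ respectively, so that $\|(a_1,\ldots,a_n)\|^2=\|\sum_j a_ja_j^*\|$. It is $C_n$-contractive if the analogous inequality holds for columns, where the column with entries $a_1,\ldots,a_n$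 has norm squared $\|\sum_j a_j^*a_j\|$. *)

(* Defs.v *)
From HB Require Import structures.
From mathcomp Require Import all_boot all_order all_algebra.
From mathcomp Require Import complex.
From mathcomp Require Import boolp classical_sets functions reals.
From mathcomp Require Import topology normedtype.
From mathcomp Require Import ring lra.

Set Implicit Arguments.
Unset Strict Implicit.
Unset Printing Implicit Defensive.

Import Order.TTheory GRing.Theory Num.Theory.
Import numFieldNormedType.Exports.

Local Open Scope classical_set_scope.
Local Open Scope ring_scope.

(* An HB structure joining Algebra and NormedModule is rejected, because the
   library's NumDomain already inherits from both PzSemiRing and
   SemiNormedZmodule. The ring operations are therefore fields of a record over
   a Banach space, and cstar_sort carries both library structures. Norms are
   R[i]-valued, as for any normedModType R[i]; they are nonnegative reals. *)
Record unitalCstar (R : realType) := UnitalCstar {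
  cstar_mod : completeNormedModType R[i] ;
  cstar_one : cstar_mod ;
  cstar_mul : cstar_mod -> cstar_mod -> cstar_mod ;
  cstar_star : cstar_mod -> cstar_mod ;
  cstar_one_neq0 : cstar_one != 0 ;
  cstar_mulA : associative cstar_mul ;
  cstar_mul1l : left_id cstar_one cstar_mul ;
  cstar_mul1r : right_id cstar_one cstar_mul ;
  cstar_mulDl : left_distributive cstar_mul +%R ;
  cstar_mulDr : right_distributive cstar_mul +%R ;
  cstar_scaleAl : forall (c : R[i]) x y,
    c *: cstar_mul x y = cstar_mul (c *: x) y ;
  cstar_scaleAr : forall (c : R[i]) x y,
    c *: cstar_mul x y = cstar_mul x (c *: y) ;
  cstar_starD : forall x y, cstar_star (x + y) = cstar_star x + cstar_star y ;
  cstar_starZ : forall (c : R[i]) x, cstar_star (c *: x) = c^* *: cstar_star x ;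
  cstar_starM : forall x y,
    cstar_star (cstar_mul x y) = cstar_mul (cstar_star y) (cstar_star x) ;
  cstar_starK : involutive cstar_star ;
  cstar_normM : forall x y, `|cstar_mul x y| <= `|x| * `|y| ;
  cstar_normS : forall x, `|cstar_mul (cstar_star x) x| = `|x| ^+ 2
}.

Definition cstar_sort (R : realType) (B : unitalCstar R) : Type := cstar_mod B.
Coercion cstar_sort : unitalCstar >-> Sortclass.

Section CstarInstances.
Variables (R : realType) (B : unitalCstar R).

HB.instance Definition _ := CompleteNormedModule.copy B (cstar_mod B).
HB.instance Definition _ := GRing.Zmodule_isNzRing.Build B
  (@cstar_mulA R B) (@cstar_mul1l R B) (@cstar_mul1r R B)
  (@cstar_mulDl R B) (@cstar_mulDr R B) (@cstar_one_neq0 R B).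
HB.instance Definition _ :=
  GRing.LSemiModule_isLSemiAlgebra.Build R[i] B (@cstar_scaleAl R B).
HB.instance Definition _ :=
  GRing.LSemiAlgebra_isSemiAlgebra.Build R[i] B (@cstar_scaleAr R B).
Definition star (x : B) : B := cstar_star x.
End CstarInstances.

(* The inner product is linear in its first argument. *)
HB.mixin Record isHilbert (R : realType) H
    of CompleteNormedModule R[i] H := {
  hdot : H -> H -> R[i] ;
  hdotDl : forall x y z, hdot (x + y) z = hdot x z + hdot y z ;
  hdotZl : forall (c : R[i]) x y, hdot (c *: x) y = c * hdot x y ;
  hdotC : forall x y, hdot x y = (hdot y x)^* ;
  hdot_norm : forall x : H, hdot x x = `|x| ^+ 2
}.

#[short(type="hilbertType")]
HB.structure Definition Hilbert (R : realType) :=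
  {H of isHilbert R H & CompleteNormedModule R[i] H}.

Section HilbertTheory.
Variables (R : realType) (H : hilbertType R).
Implicit Types (x y z : H) (c : R[i]).

Lemma hdotDr x y z : hdot x (y + z) = hdot x y + hdot x z.
Proof. by rewrite hdotC hdotDl rmorphD /= -!hdotC. Qed.

Lemma hdotZr c x y : hdot x (c *: y) = c^* * hdot x y.
Proof. by rewrite hdotC hdotZl rmorphM /= -hdotC. Qed.

Lemma hdot0l x : hdot 0 x = 0.
Proof. by rewrite -(scale0r x) hdotZl mul0r. Qed.

Lemma hdot0r x : hdot x 0 = 0.
Proof. by rewrite hdotC hdot0l rmorph0. Qed.

Lemma hdotNl x y : hdot (- x) y = - hdot x y.
Proof. by rewrite -scaleN1r hdotZl mulN1r. Qed.

Lemma hdotNr x y : hdot x (- y) = - hdot x y.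
Proof. by rewrite hdotC hdotNl rmorphN /= -hdotC. Qed.

Lemma hdot_ext x y : (forall z, hdot z x = hdot z y) -> x = y.
Proof.
move=> xy; apply/eqP; rewrite -subr_eq0 -normr_eq0 -sqrf_eq0 -hdot_norm.
by rewrite hdotDr hdotNr xy subrr.
Qed.

Lemma hdot_proj x z c : z != 0 -> c = - (hdot x z / `|z| ^+ 2) ->
  `|x + c *: z| ^+ 2 = `|x| ^+ 2 - `|hdot x z| ^+ 2 / `|z| ^+ 2.
Proof.
move=> z0 ->; rewrite -hdot_norm hdotDl !hdotDr !hdotZl !hdotZr !hdot_norm.
have nz : `|z| ^+ 2 != 0 by rewrite sqrf_eq0 normr_eq0.
have cn : (`|z| ^+ 2)^* = `|z| ^+ 2 by rewrite -hdot_norm -hdotC.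
rewrite (hdotC z x) rmorphN /= rmorphM /= fmorphV /= cn normCK !mulNr !mulrN opprK.
by rewrite -(mulrA _ _ (`|z| ^+ 2)) mulVf // mulr1; set a := hdot x z; ring.
Qed.

Lemma hdot_CS x y : `|hdot x y| <= `|x| * `|y|.
Proof.
have [->|y0] := eqVneq y 0; first by rewrite hdot0r !normr0 mulr0.
have ny : 0 < `|y| ^+ 2 by rewrite exprn_gt0 // normr_gt0.
have : 0 <= `|x + - (hdot x y / `|y| ^+ 2) *: y| ^+ 2 by rewrite exprn_ge0.
rewrite (hdot_proj y0 erefl) subr_ge0 ler_pdivrMr // -exprMn.
by rewrite ler_pXn2r // nnegrE // mulr_ge0.
Qed.

Lemma parallelogram x y :
  `|x + y| ^+ 2 + `|x - y| ^+ 2 = 2 * (`|x| ^+ 2 + `|y| ^+ 2).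
Proof.
rewrite -!hdot_norm !hdotDl !hdotDr !hdotNl !hdotNr.
by move: (hdot x x) (hdot x y) (hdot y x) (hdot y y) => a b c d; ring.
Qed.

Definition rnorm x : R := complex.Re `|x|.

Lemma rnormE x : (rnorm x)%:C%C = `|x|.
Proof. by apply: RRe_real; apply: ger0_real. Qed.

Lemma rnorm_ge0 x : 0 <= rnorm x.
Proof. by rewrite -ler0c rnormE. Qed.

Lemma riesz (f : H -> R[i]) (M : R) : scalar f ->
  (forall x, `|f x| <= M%:C%C * `|x|) -> exists v, forall x, f x = hdot x v.
Proof.
move=> flin fM.
have fD x y : f (x + y) = f x + f y by rewrite -[x]scale1r flin mul1r scale1r.
have f0 : f 0 = 0.
  by have := fD 0 0; rewrite addr0 => /eqP; rewrite -subr_eq0 opprD addNKr oppr_eq0 => /eqP.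
have fZ c x : f (c *: x) = c * f x by rewrite -[c *: x]addr0 flin f0 addr0.
have fB x y : f (x - y) = f x - f y by rewrite -scaleN1r fD fZ mulN1r.
have [[x0 fx0]|/forallNP nf] := pselect (exists x, f x != 0); last first.
  by exists 0 => x; rewrite hdot0r; apply/eqP/negPn/negP/nf.
pose K := [set x | f x = 1].
have K0 : K ((f x0)^-1 *: x0) by rewrite /K /= fZ mulVf.
pose d := inf (rnorm @` K).
have lbK : has_inf (rnorm @` K).
  split; first by exists (rnorm ((f x0)^-1 *: x0)); exists ((f x0)^-1 *: x0).
  by exists 0 => _ [x _ <-]; exact: rnorm_ge0.
have dle x : K x -> d <= rnorm x by move=> Kx; apply: ge_inf; [case: lbK|exists x].
have d0 : 0 <= d by apply: lb_le_inf; [case: lbK|move=> _ [x _ <-]; exact: rnorm_ge0].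
pose Ke (e : R) := [set x | K x /\ rnorm x < d + e].
have Kex e : 0 < e -> exists x, Ke e x.
  by move=> e0; have [_ [x Kx <-] xe] := inf_adherent e0 lbK; exists x.
pose F := filter_from [set e : R | 0 < e] Ke.
have FF : ProperFilter F.
  apply: filter_from_proper; last by move=> e /= /Kex.
  apply: filter_from_filter; first by exists 1 => /=.
  move=> a b /= a0 b0; exists (Num.min a b) => /=; first by rewrite lt_min a0 b0.
  move=> x [Kx]; rewrite -ltrBlDl lt_min => /andP[xa xb].
  by split; split=> //; rewrite -ltrBlDl.
have near2 e x y : 0 < e -> Ke e x -> Ke e y ->
    rnorm (x - y) ^+ 2 <= 4 * e * (2 * d + e).
  move=> e0 [Kx xe] [Ky ye].
  have Kxy : K ((2 : R[i])^-1 *: (x + y)).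
    by rewrite /K /= fZ fD Kx Ky -[1 + 1]/2 mulVf // pnatr_eq0.
  have := dle _ Kxy; rewrite -lecR rnormE normrZ.
  have -> : `|(2 : R[i])^-1| = 2^-1 by rewrite ger0_norm // invr_ge0 ler0n.
  rewrite mulrC ler_pdivlMr ?ltr0n // => dxy.
  have dxy' : 2 * d <= rnorm (x + y).
    by rewrite -lecR rnormE mulrC rmorphM /= (rmorph_nat (real_complex R)).
  have P : rnorm (x + y) ^+ 2 + rnorm (x - y) ^+ 2 = 2 * (rnorm x ^+ 2 + rnorm y ^+ 2).
    apply: complexI.
    rewrite [LHS]rmorphD [RHS]rmorphM [X in _ = _ * X]rmorphD !rmorphXn /= !rnormE parallelogram.
    by rewrite (rmorph_nat (real_complex R)).
  have nx := rnorm_ge0 x; have ny := rnorm_ge0 y.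
  have X : rnorm x ^+ 2 <= (d + e) ^+ 2 by rewrite ler_pXn2r ?nnegrE ?addr_ge0 // ltW.
  have Y : rnorm y ^+ 2 <= (d + e) ^+ 2 by rewrite ler_pXn2r ?nnegrE ?addr_ge0 // ltW.
  have Z : (2 * d) ^+ 2 <= rnorm (x + y) ^+ 2.
    by rewrite ler_pXn2r ?nnegrE ?mulr_ge0 ?rnorm_ge0.
  nra.
have cF : cauchy F.
  apply/cauchyP => e e0.
  have ee : e = (complex.Re e)%:C%C by rewrite RRe_real // gtr0_real.
  set r := complex.Re e in ee.
  have r0 : 0 < r by rewrite -ltcR -ee.
  pose k := 8 * d + 5.
  have k0 : 0 < k by rewrite /k; lra.
  pose q := Num.min 1 (r ^+ 2 / k).
  have q0 : 0 < q by rewrite lt_min ltr01 /= divr_gt0 // exprn_gt0.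
  have [x Kx] := Kex q q0; exists x; exists q => // y Ky.
  rewrite -ball_normE /= ee -rnormE ltcR -(@ltr_pXn2r _ 2) // ?nnegrE ?rnorm_ge0 ?(ltW r0) //.
  apply: (le_lt_trans (near2 _ _ _ q0 Kx Ky)).
  have q1 : q <= 1 by rewrite ge_min lexx.
  have qr : q * k <= r ^+ 2 by rewrite -ler_pdivlMr // ge_min lexx orbT.
  by apply: lt_le_trans qr; rewrite /k; nra.
have /cvg_ex [w Fw] := @cauchy_cvg _ F FF cF.
have appr e : 0 < e -> exists x, Ke e x /\ rnorm (w - x) < e.
  move=> e0.
  have e0' : 0 < e%:C%C :> R[i] by rewrite ltcR.
  have Fb : F (ball w e%:C%C) by apply: Fw; apply: nbhsx_ballx.
  have Fk : F (Ke e) by exists e.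
  have [x [bx kx]] := @filter_ex _ _ FF _ (filterI Fb Fk).
  by exists x; split => //; move: bx; rewrite -ball_normE /= -rnormE ltcR.
have M0 : 0 <= M.
  have := fM x0; have : 0 < `|x0| by rewrite normr_gt0; apply: contra_neq fx0 => ->.
  rewrite -rnormE -[`|f x0|](RRe_real (normr_real _)) -rmorphM /= lecR ltcR => X Y.
  have : 0 <= complex.Re `|f x0| by rewrite -ler0c RRe_real // normr_real.
  move=> /le_trans /(_ Y); rewrite pmulr_lge0 //.
have Kw : K w.
  rewrite /K /=; apply/eqP; rewrite -subr_eq0 -normr_eq0.
  rewrite -[`|_|](RRe_real (normr_real _)); set t := complex.Re _.
  have tt : t%:C%C = `|f w - 1| by rewrite RRe_real // normr_real.
  have t0 : 0 <= t by rewrite -ler0c tt.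
  suff t0' : t <= 0 by have -> : t = 0 by apply: le_anti; rewrite t0 t0'.
  apply/ler_addgt0Pr => e e0; rewrite add0r.
  have [|x [[Kx _] wx]] := appr (e / (M + 1)); first by rewrite divr_gt0 // ltr_wpDl.
  have := fM (w - x); rewrite fB Kx -tt -rnormE -rmorphM /= lecR.
  move=> /le_trans; apply.
  rewrite ltr_pdivlMr ?ltr_wpDl // in wx.
  have := rnorm_ge0 (w - x); nra.
have wd : rnorm w <= d.
  apply/ler_addgt0Pr => e e0.
  have [|x [[Kx xd] wx]] := appr (e / 2); first by rewrite divr_gt0.
  have : rnorm w <= rnorm (w - x) + rnorm x.
    by rewrite -lecR rmorphD /= !rnormE -{1}(subrK x w) ler_normD.
  lra.
have w0 : w != 0 by apply/eqP => w0; move: Kw; rewrite /K /= w0 f0 => /esym/eqP; rewrite oner_eq0.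
have orth z : f z = 0 -> hdot w z = 0.
  move=> fz; have [->|z0] := eqVneq z 0; first by rewrite hdot0r.
  have Kz : K (w + - (hdot w z / `|z| ^+ 2) *: z) by rewrite /K /= fD fZ fz mulr0 addr0.
  have := le_trans wd (dle _ Kz); rewrite -lecR !rnormE => le1.
  have : `|w| ^+ 2 <= `|w + - (hdot w z / `|z| ^+ 2) *: z| ^+ 2 by rewrite ler_pXn2r ?nnegrE.
  have nz : 0 < `|z| ^+ 2 by rewrite exprn_gt0 // normr_gt0.
  rewrite (hdot_proj z0 erefl) lerBrDr gerDl pmulr_lle0 ?invr_gt0 // => le2.
  have /eqP : `|hdot w z| ^+ 2 = 0 by apply/eqP; rewrite eq_le le2 exprn_ge0.
  by rewrite sqrf_eq0 normr_eq0 => /eqP.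
exists ((`|w| ^+ 2)^-1 *: w) => x.
have nw : `|w| ^+ 2 != 0 by rewrite sqrf_eq0 normr_eq0.
have cw : (`|w| ^+ 2)^* = `|w| ^+ 2 by rewrite -hdot_norm -hdotC.
have := orth (x - f x *: w); rewrite fB fZ Kw mulr1 subrr => /(_ erefl).
rewrite hdotC hdotDl hdotNl hdotZl hdot_norm => /eqP; rewrite conjC_eq0 subr_eq0 => /eqP E.
by rewrite hdotZr fmorphV /= cw E mulrC mulfK.
Qed.

End HilbertTheory.

Section BoundedOperators.
Variables (R : realType) (H : hilbertType R).

(* bop below is B(H): the linear maps H -> H that are bounded. *)
Definition bounded_op : {pred H -> H} := fun f =>
  `[< linear f /\ exists M : R, forall x, `|f x| <= M%:C%C * `|x| >].

Lemma bounded_opP (f : H -> H) : reflect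
  (linear f /\ exists2 M : R, 0 <= M & forall x, `|f x| <= M%:C%C * `|x|)
  (f \in bounded_op).
Proof.
apply: (iffP (asboolP _)) => -[flin] => [[M fM]|[M M0 fM]]; split => //; last by exists M.
exists `|M| => // x; apply: le_trans (fM x) _.
by rewrite ler_wpM2r // lecR ler_norm.
Qed.

Lemma bounded_op_submod : submod_closed bounded_op.
Proof.
split.
  apply/bounded_opP; split; first by move=> c x y /=; rewrite scaler0 addr0.
  by exists 0 => // x; rewrite normr0 mul0r.
move=> c f g /bounded_opP[fl [M M0 fM]] /bounded_opP[gl [N N0 gN]].
apply/bounded_opP; split.
  move=> a x y; rewrite !fctE /= fl gl !scalerDr !scalerA (mulrC c a).
  by rewrite -!addrA; congr (_ + _); rewrite addrCA.
exists (complex.Re `|c| * M + N).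
  by rewrite addr_ge0 // mulr_ge0 // -ler0c RRe_real // normr_real.
move=> x; have -> : (complex.Re `|c| * M + N)%:C%C = `|c| * M%:C%C + N%:C%C.
  rewrite -[in RHS](RRe_real (normr_real c)); set r := complex.Re _.
  by rewrite rmorphD rmorphM.
rewrite (le_trans (ler_normD _ _)) // mulrDl lerD // normrZ -mulrA.
by rewrite ler_wpM2l.
Qed.

HB.instance Definition _ :=
  GRing.isSubmodClosed.Build R[i] (H -> H) bounded_op bounded_op_submod.

Record bop := Bop { bop_fun :> H -> H ; _ : bop_fun \in bounded_op }.

HB.instance Definition _ := [isSub for bop_fun].
HB.instance Definition _ := [Choice of bop by <:].
HB.instance Definition _ := [SubChoice_isSubLmodule of bop by <:].

Lemma bopP (S T : bop) : S =1 T -> S = T.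
Proof. by move=> ST; apply/val_inj/funext. Qed.

Lemma bop_linear (T : bop) : linear T.
Proof. by case: T => f /= /bounded_opP[]. Qed.

HB.instance Definition _ (T : bop) :=
  GRing.isLinear.Build R[i] H H *:%R T (bop_linear T).

Lemma bop_bounded (T : bop) :
  exists2 M : R, 0 <= M & forall x, `|T x| <= M%:C%C * `|x|.
Proof. by case: T => f /= /bounded_opP[]. Qed.

Lemma bop_id_subproof : @id H \in bounded_op.
Proof. by apply/bounded_opP; split=> //; exists 1 => // x; rewrite mul1r. Qed.

Lemma bop_comp_subproof (S T : bop) : S \o T \in bounded_op.
Proof.
apply/bounded_opP; split; first by move=> c x y /=; rewrite !linearP.
have [M M0 SM] := bop_bounded S; have [N N0 TN] := bop_bounded T.
exists (M * N) => [|x /=]; first exact: mulr_ge0.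
rewrite (le_trans (SM _)) // rmorphM /= -mulrA ler_wpM2l // ler0c //.
Qed.

Definition bop_one := Bop bop_id_subproof.
Definition bop_mul (S T : bop) := Bop (bop_comp_subproof S T).

Lemma bop_mulA : associative bop_mul.
Proof. by move=> S T U; apply: bopP. Qed.
Lemma bop_mul1l : left_id bop_one bop_mul.
Proof. by move=> S; apply: bopP. Qed.
Lemma bop_mul1r : right_id bop_one bop_mul.
Proof. by move=> S; apply: bopP. Qed.
Lemma bop_mulDl : left_distributive bop_mul +%R.
Proof. by move=> S T U; apply: bopP. Qed.
Lemma bop_mulDr : right_distributive bop_mul +%R.
Proof. by move=> S T U; apply: bopP => x; exact: (linearD S). Qed.

(* H may be the zero space, so B(H) is only a possibly trivial ring. *)
HB.instance Definition _ := GRing.Zmodule_isPzRing.Build bop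
  bop_mulA bop_mul1l bop_mul1r bop_mulDl bop_mulDr.

Lemma adjoint_exists (T : bop) :
  exists S : bop, forall x y, hdot (T x) y = hdot x (S y).
Proof.
have [M M0 TM] := bop_bounded T.
have rz y : exists v, forall x, hdot (T x) y = hdot x v.
  apply: (@riesz R H _ (M * rnorm y)).
    by move=> c u v; rewrite linearP hdotDl hdotZl.
  move=> x; rewrite (le_trans (hdot_CS _ _)) // rmorphM /= rnormE mulrAC.
  by rewrite ler_wpM2r.
have [S ST] := choice rz.
suff Sb : S \in bounded_op by exists (Bop Sb) => x y; exact: ST.
apply/bounded_opP; split.
  move=> c y z; apply: hdot_ext => x.
  by rewrite hdotDr hdotZr -!ST hdotDr hdotZr.
exists M => // y.
have [->|Sy0] := eqVneq (S y) 0; first by rewrite normr0 mulr_ge0 // ler0c.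
have Sy : 0 < `|S y| by rewrite normr_gt0.
have E : `|S y| ^+ 2 = `|hdot (T (S y)) y|.
  by rewrite ST hdot_norm normrX normr_id.
rewrite -(ler_pM2r Sy) -expr2 E (le_trans (hdot_CS _ _)) // mulrAC.
by rewrite ler_wpM2r.
Qed.

Definition adjoint (T : bop) : bop := projT1 (cid (adjoint_exists T)).

Lemma adjointE (T : bop) x y : hdot (T x) y = hdot x (adjoint T y).
Proof. by rewrite /adjoint; case: cid. Qed.

End BoundedOperators.

Section Invertible.
Variable U : pzRingType.
Definition invertible (x : U) : Prop := exists y, x * y = 1 /\ y * x = 1.
End Invertible.

Section Positivity.
Variables (R : realType) (B : unitalCstar R) (H : hilbertType R).

Definition mx_star n (X : 'M[B]_n) : 'M[B]_n := (map_mx (@star R B) X)^T.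

(* b is positive iff it has the form c^* c. *)
Definition cstar_pos (b : B) : Prop := exists c, b = star c * c.

(* The same definition of positivity, in the C*-algebra M_n(B). *)
Definition mx_pos n (P : 'M[B]_n) : Prop := exists X, P = mx_star X *m X.

Definition bop_pos (T : bop H) : Prop := forall h, 0 <= hdot (T h) h.

Definition bop_le (S T : bop H) : Prop := bop_pos (T - S).

(* Positivity in M_n(B(H)), an n x n matrix of operators acting on H^(n). *)
Definition bop_mx_pos n (T : 'M[bop H]_n) : Prop :=
  forall h : 'I_n -> H, 0 <= \sum_i hdot (\sum_j T i j (h j)) (h i).

Definition positive_map (Phi : B -> bop H) : Prop :=
  forall b, cstar_pos b -> bop_pos (Phi b).

Definition completely_positive (Phi : B -> bop H) : Prop :=
  forall n (P : 'M[B]_n), mx_pos P -> bop_mx_pos (map_mx Phi P).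

End Positivity.

Section Logmodular.
Variables (R : realType) (B : unitalCstar R) (S : pred B) (A : subAlgType S).

(* A subAlgType of B is a unital subalgebra, not necessarily closed, embedded
   in B by val; invertible a is invertibility within A. *)
Definition logmodular : Prop :=
  [set b : B | cstar_pos b /\ invertible b] `<=`
  closure [set star (val a) * val a | a in [set a : A | invertible a]].

End Logmodular.

Section Contractive.
Variables (R : realType) (B : unitalCstar R) (H : hilbertType R).

(* The norms of M_{1,n}(B) and M_{n,1}(B). *)
Definition row_norm n (a : 'I_n -> B) : R :=
  Num.sqrt (complex.Re `|\sum_j a j * star (a j)|).

Definition col_norm n (a : 'I_n -> B) : R :=
  Num.sqrt (complex.Re `|\sum_j star (a j) * a j|).

(* The norm of a vector of the Hilbert space H^(n). *)
Definition hsum_norm n (h : 'I_n -> H) : R :=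
  Num.sqrt (\sum_j rnorm (h j) ^+ 2).

(* The operator norms of B(H^(n), H) and B(H, H^(n)). *)
Definition row_opnorm n (T : 'I_n -> bop H) : R :=
  sup [set rnorm (\sum_j T j (h j)) | h in [set h | hsum_norm h <= 1]].

Definition col_opnorm n (T : 'I_n -> bop H) : R :=
  sup [set hsum_norm (fun j => T j h) | h in [set h | rnorm h <= 1]].

Variables (S : pred B) (A : subAlgType S).

Definition R_contractive n (rho : A -> bop H) : Prop :=
  forall a : 'I_n -> A, row_opnorm (rho \o a) <= row_norm (val \o a).

Definition C_contractive n (rho : A -> bop H) : Prop :=
  forall a : 'I_n -> A, col_opnorm (rho \o a) <= col_norm (val \o a).

Definition schwarz_extension (rho : A -> bop H) (Phi : B -> bop H) : Prop :=
  [/\ positive_map Phi,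
      forall a : A, Phi (val a) = rho a,
      forall a : A, bop_le (adjoint (rho a) * rho a)
                           (Phi (star (val a) * val a)) &
      forall a : A, bop_le (rho a * adjoint (rho a))
                           (Phi (val a * star (val a)))].

End Contractive.

(* Main.v *)
Require Import Defs.
From HB Require Import structures.
From mathcomp Require Import all_boot all_order all_algebra.
From mathcomp Require Import complex.
From mathcomp Require Import boolp classical_sets reals.
From mathcomp Require Import topology normedtype.
From mathcomp Require Import ring lra.
Import Order.TTheory GRing.Theory Num.Theory.
Import numFieldNormedType.Exports.
Local Open Scope classical_set_scope.
Local Open Scope ring_scope.

(** The theorem is the infinitesimal version of the classical argument that
    a logmodular algebra has unique representing measures.

    Fix h in H and read a |-> |rho(a) h|^2 as a function of a^* a. For c
    invertible, an inequality m1 a1^* a1 + m2 a2^* a2 <= k c^* c says that the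
    column of the sqrt(mi) ai c^-1 has squared norm at most k, so
    C_2-contractivity gives m1 |rho(a1) h|^2 + m2 |rho(a2) h|^2 <=
    k |rho(c) h|^2 (colval_dominated). As the c^* c are dense in the positive
    invertible elements, this defines a superadditive, positively homogeneous,
    hence concave function there, whose value at c^* c is |rho(c) h|^2. Its
    directional derivative D_h(u) at 1 (tangent, col_tangent) is a superlinear
    function of the self-adjoint element u, nonnegative on positive elements,
    with D_h(a^* a) >= |rho(a) h|^2. Rows, R_2-contractivity and
    |rho(a)^* h|^2 as a function of a a^* give in the same way a superlinear
    E_h with E_h(a a^* ) >= |rho(a)^* h|^2.

    An invertible a with inverse c links the two: c c^* is the inverse of a^* a,
    and <rho(a) h, rho(c)^* h> = |h|^2 bounds the product of |rho(a) h|^2 and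
    |rho(c)^* h|^2 below by |h|^4. With a^* a close to s + u and s large, the
    arithmetic-geometric mean inequality then yields D_h(u) + E_h(-u) >= 0
    (tangent_approx). Superadditivity says D_h(u) + D_h(-u) <= 0, and likewise
    for E_h, so D_h = E_h is odd, hence real linear (col_tangent_eq_row). This is
    where both contractivity hypotheses are used together.

    The same estimate squeezes D_h(u) between q(h) and q(h) + e |h|^2, where q
    is the quadratic form of the operator rho(a)^* rho(a) - s. A uniform limit
    of quadratic forms of operators is one again (quad_form_limit), so
    D_h(u) = <Phi(u) h, h> for an operator Phi(u); complexified, Phi is the
    required extension.

    For uniqueness, let Phi' be a positive extension of rho satisfying the first
    Schwarz inequality. Each competitor in the supremum defining D_h(u) is at
    most <Phi'(u) h, h>, so <Phi'(u) h, h> >= D_h(u); both sides are odd in u,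
    hence equal (schwarz_extension_form). A completely positive extension is of
    this kind by the Schwarz inequality for 2-positive unital maps.

    Positivity in B is handled through the criterion that |t - x| <= t for some
    t, which makes the cone property immediate; psd_starM (Kelley and Vaught)
    identifies it with being of the form c^* c. *)

Set Implicit Arguments.
Unset Strict Implicit.
Unset Printing Implicit Defensive.

Local Notation "r *r x" := (r%:C%C *: x) (at level 40, left associativity).

(** * Real scalars and real-valued norms *)

Section RealScalars.
Variable R : realType.
Implicit Types r t K x : R.

(** Discharges the epsilon arguments below, where errors are only controlled up
    to a fixed factor. *)
Lemma le0_eps K r : (forall e, 0 < e -> r <= K * e) -> r <= 0.
Proof.
move=> rK; apply/ler_addgt0Pr => e e0; rewrite add0r.
have K1 : 0 < `|K| + 1 by rewrite ltr_wpDl.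
have := rK (e / (`|K| + 1)) (divr_gt0 e0 K1) => /le_trans; apply.
rewrite mulrCA ger_pMr // ler_pdivrMr // mul1r.
by have := ler_norm K; lra.
Qed.

Lemma norm_real_complex r : `|r%:C%C : R[i]| = `|r|%:C%C.
Proof. by rewrite normc_def expr0n addr0 sqrtr_sqr. Qed.

Lemma conj_real_complex r : (r%:C%C : R[i])^* = r%:C%C.
Proof.
by apply: conj_Creal; rewrite realE; have := le_total 0 r; rewrite -!lecR.
Qed.

Lemma complex_parts (c : R[i]) : c = (complex.Re c)%:C%C + 'i * (complex.Im c)%:C%C.
Proof. by rewrite {1}(complexE c). Qed.

(** The derivative at 0 of a quadratic polynomial that is minimal there. *)
Lemma slope_eq0 x K : (forall t, 0 <= 2 * t * x + t ^+ 2 * K) -> x = 0.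
Proof.
move=> xK; apply/eqP; rewrite -normr_eq0 eq_le normr_ge0 andbT.
apply: (@le0_eps (`|K|)) => e e0.
have := xK (e); have := xK (- e); have := ler_norm K; have := ler_norm (- K).
rewrite normrN; have [x0|x0] := ger0P x => h1 h2 h3 h4; nra.
Qed.

(** The arithmetic-geometric mean inequality for x and k y, with x y >= n^2; the
    form with s - e keeps only the lower bound on the square root of k that is
    available when k is close to s^2. *)
Lemma amgm_gap (x y k s e n : R) : 0 <= x -> 0 <= y -> 0 <= n -> n ^+ 2 <= x * y ->
  0 <= e -> e <= s -> (s - e) ^+ 2 <= k -> 2 * (s - e) * n <= x + k * y.
Proof.
move=> x0 y0 n0 nxy e0 es sk.
have k0 : 0 <= k := le_trans (sqr_ge0 _) sk.
rewrite -(@ler_pXn2r _ 2) ?nnegrE ?addr_ge0 ?mulr_ge0 ?subr_ge0 //.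
have h1 : ((s - e) * n) ^+ 2 <= k * (x * y).
  by rewrite exprMn; apply: ler_pM => //; exact: sqr_ge0.
have h2 := sqr_ge0 (x - k * y).
have -> : (2 * (s - e) * n) ^+ 2 = 4 * ((s - e) * n) ^+ 2 by ring.
nra.
Qed.

End RealScalars.

Section Norm.
Variables (R : realType) (B : unitalCstar R).
Implicit Types (x y z : B) (r s t : R).

(** Norms of B live in R[i]; the real part is taken so that real arithmetic
    applies. *)
Definition nrm x : R := complex.Re `|x|.

Lemma nrmE x : (nrm x)%:C%C = `|x|.
Proof. by apply: RRe_real; apply: ger0_real. Qed.

Lemma nrm_ge0 x : 0 <= nrm x.
Proof. by rewrite -ler0c nrmE. Qed.

Lemma nrmD x y : nrm (x + y) <= nrm x + nrm y.
Proof. by rewrite -lecR rmorphD /= !nrmE ler_normD. Qed.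

Lemma nrmN x : nrm (- x) = nrm x.
Proof. by rewrite /nrm normrN. Qed.

Lemma nrmB x y : nrm (x - y) <= nrm x + nrm y.
Proof. by rewrite -(nrmN y) nrmD. Qed.

Lemma nrmBC x y : nrm (x - y) = nrm (y - x).
Proof. by rewrite -opprB nrmN. Qed.

Lemma nrm_split z x y : nrm (x - y) <= nrm (x - z) + nrm (z - y).
Proof. by rewrite -{1}(subrK z x) -addrA nrmD. Qed.

Lemma nrmM x y : nrm (x * y) <= nrm x * nrm y.
Proof. by rewrite -lecR rmorphM /= !nrmE; exact: cstar_normM. Qed.

Lemma nrmZ r x : nrm (r *r x) = `|r| * nrm x.
Proof.
apply: complexI; rewrite rmorphM /= !nrmE normrZ.
by rewrite norm_real_complex.
Qed.

Lemma nrm_unimodular (c : R[i]) x : `|c| = 1 -> nrm (c *: x) = nrm x.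
Proof. by move=> c1; rewrite /nrm normrZ c1 mul1r. Qed.

Lemma nrm0 : nrm (0 : B) = 0.
Proof. by rewrite /nrm normr0. Qed.

Lemma nrm_eq0 x : nrm x = 0 -> x = 0.
Proof. by move=> x0; apply/eqP; rewrite -normr_eq0 -nrmE x0. Qed.

Lemma nrm_eps0 (K : R) x : (forall e, 0 < e -> nrm x <= K * e) -> x = 0.
Proof.
by move=> xK; apply/nrm_eq0/le_anti; rewrite nrm_ge0 andbT; exact: le0_eps xK.
Qed.

Lemma rscDl r s x : (r + s) *r x = r *r x + s *r x.
Proof. by rewrite rmorphD scalerDl. Qed.

Lemma rscBl r s x : (r - s) *r x = r *r x - s *r x.
Proof. by rewrite rmorphB scalerBl. Qed.

Lemma rscA r s x : r *r (s *r x) = (r * s) *r x.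
Proof. by rewrite scalerA rmorphM. Qed.

Lemma rsc1 x : 1 *r x = x.
Proof. by rewrite scale1r. Qed.

Lemma rsc0 x : 0 *r x = 0.
Proof. by rewrite scale0r. Qed.

Lemma rscN r x : (- r) *r x = - (r *r x).
Proof. by rewrite rmorphN scaleNr. Qed.

Lemma rsc_nat n x : (n%:R) *r x = x *+ n.
Proof. by rewrite (rmorph_nat (real_complex R)) scaler_nat. Qed.

Lemma rscMl r x y : (r *r x) * y = r *r (x * y).
Proof. by rewrite scalerAl. Qed.

Lemma rscMr r x y : x * (r *r y) = r *r (x * y).
Proof. by rewrite scalerAr. Qed.

Lemma starD x y : star (x + y) = star x + star y.
Proof. exact: cstar_starD. Qed.

Lemma starZ (c : R[i]) x : star (c *: x) = c^* *: star x.
Proof. exact: cstar_starZ. Qed.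

Lemma star_rsc r x : star (r *r x) = r *r star x.
Proof. by rewrite starZ conj_real_complex. Qed.

Lemma star0 : star (0 : B) = 0.
Proof. by apply: (addrI (star 0)); rewrite -starD !addr0. Qed.

Lemma starN x : star (- x) = - star x.
Proof. by apply/eqP; rewrite -addr_eq0 -starD addNr star0. Qed.

Lemma starB x y : star (x - y) = star x - star y.
Proof. by rewrite starD starN. Qed.

Lemma starM x y : star (x * y) = star y * star x.
Proof. exact: cstar_starM. Qed.

Lemma starK x : star (star x) = x.
Proof. exact: cstar_starK. Qed.

Lemma star1 : star (1 : B) = 1.
Proof. by rewrite -[star 1]mul1r -{1}(starK 1) -starM mul1r starK. Qed.

Lemma nrmS x : nrm (star x * x) = nrm x ^+ 2.
Proof. by apply: complexI; rewrite rmorphXn /= !nrmE; exact: cstar_normS. Qed.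

Lemma nrm_star x : nrm (star x) = nrm x.
Proof.
have le y : nrm y <= nrm (star y).
  have [->|y0] := eqVneq y 0; first by rewrite star0.
  have ny : 0 < nrm y.
    by rewrite lt_def nrm_ge0 andbT; apply: contra_neq y0; exact: nrm_eq0.
  by rewrite -(ler_pM2r ny) -expr2 -nrmS nrmM.
by apply/eqP; rewrite eq_le le -{2}(starK x) le.
Qed.

Lemma nrmSr x : nrm (x * star x) = nrm x ^+ 2.
Proof. by rewrite -{1}(starK x) nrmS nrm_star. Qed.

Lemma nrm_sq x : star x = x -> nrm (x * x) = nrm x ^+ 2.
Proof. by move=> sx; rewrite -{1}sx nrmS. Qed.

Lemma nrm1 : nrm (1 : B) = 1.
Proof.
have n1 : nrm (1 : B) != 0.
  by apply/eqP => /nrm_eq0/eqP; rewrite oner_eq0.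
by apply: (mulfI n1); rewrite mulr1 -expr2 -nrm_sq ?star1 // mulr1.
Qed.

Lemma nrm_rsc1 r : nrm (r *r 1 : B) = `|r|.
Proof. by rewrite nrmZ nrm1 mulr1. Qed.

(** The method of majorants: increments dominated by those of a bounded real
    sequence force convergence. Both the Neumann series and the square root are
    obtained this way, the latter also in the boundary case where the iteration
    is not a contraction. *)
Lemma majorant_lim (y : nat -> B) (t : nat -> R) (M : R) :
  (forall n, t n <= M) ->
  (forall n, nrm (y n.+1 - y n) <= t n.+1 - t n) ->
  exists l, forall e, 0 < e -> exists N, forall n, (N <= n)%N ->
    nrm (l - y n) <= e.
Proof.
move=> tM yt.
have yt' m n : (m <= n)%N -> nrm (y n - y m) <= t n - t m.
  elim: n => [|n IH]; first by rewrite leqn0 => /eqP->; rewrite !subrr nrm0.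
  rewrite leq_eqVlt => /orP[/eqP->|]; first by rewrite !subrr nrm0.
  rewrite ltnS => mn; apply: le_trans (nrm_split (y n) _ _) _.
  by have := yt n; have := IH mn; lra.
have tN e : 0 < e -> exists N, forall n, (N <= n)%N -> t n - t N <= e.
  move=> e0; have lb : has_sup (range t).
    by split; [exists (t 0), 0|exists M => _ [n _ <-]].
  have [_ [N _ <-] tNe] := sup_adherent e0 lb.
  exists N => n _; have : t n <= sup (range t) by apply: sup_ubound; [case: lb|exists n].
  by lra.
have cy : cauchy (y @ \oo).
  apply/cauchyP => e e0.
  have ee : e = (complex.Re e)%:C%C by rewrite RRe_real // gtr0_real.
  have r0 : 0 < complex.Re e / 2 by rewrite divr_gt0 // -ltcR -ee.
  have [N tNe] := tN _ r0; exists (y N), N => // n /= Nn.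
  rewrite -ball_normE /= ee -nrmE ltcR nrmBC.
  by have := yt' _ _ Nn; have := tNe n Nn; lra.
have yl : cvg (y @ \oo) by exact: cauchy_cvg.
exists (lim (y @ \oo)) => e e0.
have [N _ yN] : (y @ \oo) (ball (lim (y @ \oo)) e%:C%C).
  by apply: yl; apply: nbhsx_ballx; rewrite ltcR.
exists N => n Nn; have := yN n Nn.
by rewrite /= -ball_normE /= -nrmE ltcR => /ltW.
Qed.

(** Neumann series, summed by the iteration y |-> 1 + x y. *)
Lemma invertible_near1 x : nrm x < 1 -> invertible (1 - x).
Proof.
move=> x1; have x0 := nrm_ge0 x; have q0 : 0 < 1 - nrm x by rewrite subr_gt0.
pose y n : B := iter n (fun y => 1 + x * y) 0.
pose t n : R := iter n (fun t => 1 + nrm x * t) 0.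
have tM n : 0 <= t n <= (1 - nrm x)^-1.
  elim: n => [|n /andP[IH0 IH]] /=; first by rewrite lexx invr_ge0 ltW.
  have IH' : t n * (1 - nrm x) <= 1 by rewrite -ler_pdivlMr // div1r.
  by rewrite addr_ge0 ?mulr_ge0 //= -[leRHS]div1r ler_pdivlMr //; rewrite -/(t n); nra.
have yt n : nrm (y n.+1 - y n) <= t n.+1 - t n.
  elim: n => [|n IH]; first by rewrite /= mulr0 addr0 !subr0 mulr0 addr0 nrm1.
  have -> : y n.+2 - y n.+1 = x * (y n.+1 - y n).
    by rewrite mulrBr /= [_ * y n]lock; rewrite -lock opprD addrACA subrr add0r.
  have -> : t n.+2 - t n.+1 = nrm x * (t n.+1 - t n) by rewrite /=; ring.
  by apply: le_trans (nrmM _ _) _; rewrite ler_wpM2l.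
have yx n : y n * x = x * y n.
  by elim: n => [|n IH] /=; rewrite ?mul0r ?mulr0 // mulrDl mulrDr mul1r mulr1 -mulrA IH.
have [l yl] := majorant_lim (fun n => proj2 (andP (tM n))) yt.
have l1 : l = 1 + x * l.
  apply/eqP; rewrite -subr_eq0; apply/eqP; apply: (@nrm_eps0 2) => e e0.
  have [n lN] := yl e e0; have := lN n (leqnn n); have := lN n.+1 (leqnSn n) => h1 h2.
  apply: le_trans (nrm_split (y n.+1) _ _) _.
  have -> : y n.+1 - (1 + x * l) = x * (y n - l) by rewrite /= opprD addrACA subrr add0r -mulrBr.
  have := nrmM x (y n - l); rewrite [nrm (y n - l)]nrmBC.
  have := nrm_ge0 (l - y n); nra.
have xl : l * x = x * l.
  apply/eqP; rewrite -subr_eq0; apply/eqP; apply: (@nrm_eps0 2) => e e0.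
  have [K /(_ _ (leqnn _)) lK] := yl e e0.
  apply: le_trans (nrm_split (y K * x) _ _) _; rewrite {2}yx -mulrBl -mulrBr.
  have := nrmM x (y K - l); have := nrmM (l - y K) x; rewrite [nrm (y K - l)]nrmBC.
  have := nrm_ge0 (l - y K); nra.
exists l; split.
  by rewrite mulrBl mul1r {1}l1 addrK.
by rewrite mulrBr mulr1 xl {1}l1 addrK.
Qed.

End Norm.

(** * Identities that are linear over the reals *)

Section Linear.
Variables (R : realType) (B : unitalCstar R).

(** Syntax of linear combinations, used to prove identities in B that hold for
    linear reasons by comparing real coefficients. Products in B are atoms. *)
Inductive lin := LinAtom of nat | LinZero | LinOpp of lin | LinAdd of lin & lin | LinScale of R & lin.

Fixpoint lin_eval (env : seq B) e : B :=
  match e with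
  | LinAtom n => nth 0 env n
  | LinZero => 0
  | LinOpp e => - lin_eval env e
  | LinAdd e f => lin_eval env e + lin_eval env f
  | LinScale r e => r *r lin_eval env e
  end.

Fixpoint lin_coef i e : R :=
  match e with
  | LinAtom n => (n == i)%:R
  | LinZero => 0
  | LinOpp e => - lin_coef i e
  | LinAdd e f => lin_coef i e + lin_coef i f
  | LinScale r e => r * lin_coef i e
  end.

Fixpoint lin_agree n e f : Prop :=
  if n is n'.+1 then lin_coef n' e = lin_coef n' f /\ lin_agree n' e f else True.

Lemma lin_evalE env e :
  lin_eval env e = \sum_(i < size env) lin_coef i e *r nth 0 env i.
Proof.
elim: e => [n||e IH|e IHe f IHf|r e IH] /=.
- have [nlt|nge] := ltnP n (size env).
    rewrite (bigD1 (Ordinal nlt)) //= eqxx rsc1 big1 ?addr0 // => i /eqP ni.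
    case: eqP => [ni'|_]; last exact: rsc0.
    by case: ni; apply: val_inj.
  rewrite nth_default // big1 // => i _.
  by rewrite gtn_eqF ?rsc0 // (leq_trans (ltn_ord i)).
- by rewrite big1 // => i _; rewrite rsc0.
- by rewrite IH -sumrN; apply: eq_bigr => i _; rewrite rscN.
- by rewrite IHe IHf -big_split; apply: eq_bigr => i _; rewrite rscDl.
- by rewrite IH scaler_sumr; apply: eq_bigr => i _; rewrite rscA.
Qed.

Lemma lin_evalP env e f : lin_agree (size env) e f -> lin_eval env e = lin_eval env f.
Proof.
rewrite !lin_evalE; elim: (size env) => [|n IH] /= => [_|[ef /IH{}IH]].
  by rewrite !big_ord0.
by rewrite !big_ord_recr /= IH ef.
Qed.

End Linear.

(** Atoms are compared up to conversion, since the same term may carry different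
    but convertible algebraic structures. *)
Ltac lin_mem x env :=
  lazymatch env with
  | nil => false
  | ?y :: ?env =>
    match constr:(Set) with
    | _ => let _ := constr:(erefl x : x = y) in true
    | _ => lin_mem x env
    end
  end.
Ltac lin_index x env :=
  lazymatch env with
  | ?y :: ?env =>
    match constr:(Set) with
    | _ => let _ := constr:(erefl x : x = y) in constr:(0%N)
    | _ => let n := lin_index x env in constr:(S n)
    end
  end.
Ltac lin_atoms env e :=
  lazymatch e with
  | 0 => env
  | - ?x => lin_atoms env x
  | ?x + ?y => let env := lin_atoms env x in lin_atoms env y
  | _ *r ?x => lin_atoms env x
  | ?x => lazymatch lin_mem x env with true => env | false => constr:(x :: env) end
  end.
Ltac lin_reify R env e :=
  lazymatch e with
  | 0 => constr:(@LinZero R)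
  | - ?x => let x := lin_reify R env x in constr:(LinOpp x)
  | ?x + ?y => let x := lin_reify R env x in let y := lin_reify R env y in constr:(LinAdd x y)
  | ?r *r ?x => let x := lin_reify R env x in constr:(LinScale r x)
  | ?x => let n := lin_index x env in constr:(@LinAtom R n)
  end.
(** Reduces an identity in B to one real identity per atom. *)
Ltac linear_identity :=
  match goal with
  | B : unitalCstar ?R |- ?e = ?f =>
    let env := lin_atoms (@nil (@cstar_sort R B)) e in
    let env := lin_atoms env f in
    let e' := lin_reify R env e in
    let f' := lin_reify R env f in
    apply: (@lin_evalP R B env e' f'); rewrite /=; repeat split
  end.

(** * Positive elements of a C*-algebra *)

Section Order.
Variables (R : realType) (B : unitalCstar R).
Implicit Types (x y z : B) (r s t : R).

(** Positivity, stated so that sums of positive elements are clearly positive: for x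
    self-adjoint, |t - x| <= t places the spectrum of x in [0, 2t]. *)
Definition psd x := star x = x /\ exists t, nrm (t *r 1 - x) <= t.

Lemma psd_large x : psd x ->
  exists t0, forall t, t0 <= t -> nrm (t *r 1 - x) <= t.
Proof.
move=> [_ [t0 xt0]]; exists t0 => t t0t.
apply: le_trans (nrm_split (t0 *r 1) _ _) _.
by rewrite -rscBl nrm_rsc1 ger0_norm ?subr_ge0 //; lra.
Qed.

Lemma psdD x y : psd x -> psd y -> psd (x + y).
Proof.
move=> [sx [t xt]] [sy [s ys]]; split; first by rewrite starD sx sy.
exists (t + s); rewrite rscDl opprD addrACA.
by apply: le_trans (nrmD _ _) _; lra.
Qed.

Lemma psdZ r x : 0 <= r -> psd x -> psd (r *r x).
Proof.
move=> r0 [sx [t xt]]; split; first by rewrite star_rsc sx.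
exists (r * t); rewrite -rscA -scalerBr nrmZ ger0_norm //.
by rewrite ler_wpM2l.
Qed.

Lemma psd_scalar r : 0 <= r -> psd (r *r 1).
Proof.
by move=> r0; split; [rewrite star_rsc star1|exists r; rewrite subrr nrm0].
Qed.

Lemma psd_scalarB M x : star x = x -> nrm x <= M -> psd (M *r 1 - x).
Proof.
move=> sx xM; split; first by rewrite starB star_rsc star1 sx.
by exists M; rewrite opprB addrC subrK.
Qed.

Lemma psd_scalarD M x : star x = x -> nrm x <= M -> psd (M *r 1 + x).
Proof.
by move=> sx xM; rewrite -(opprK x); apply: psd_scalarB; rewrite ?starN ?sx ?nrmN.
Qed.

(** The solution y of y = (x + y^2) / 2 is 1 minus the square root of 1 - x. The
    scalar iteration t |-> (1 + t^2) / 2 started at 0 stays below 1 and majorizes the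
    iteration in B. Commutation with the commutant of x passes to the limit and
    replaces the functional calculus below. *)
Lemma sqrt_one_minus x : star x = x -> nrm x <= 1 ->
  exists y, [/\ star y = y, nrm y <= 1, (1 - y) * (1 - y) = 1 - x &
    forall c, c * x = x * c -> c * y = y * c].
Proof.
move=> sx x1.
pose y n : B := iter n (fun y => 2^-1 *r (x + y * y)) 0.
pose t n : R := iter n (fun t => 2^-1 * (1 + t ^+ 2)) 0.
have yS n : y n.+1 = 2^-1 *r (x + y n * y n) by [].
have tS n : t n.+1 = 2^-1 * (1 + t n ^+ 2) by [].
have tM n : 0 <= t n <= 1 by elim: n => [|n IH]; [rewrite lexx ler01|rewrite tS; nra].
have yt n : nrm (y n) <= t n.
  elim: n => [|n IH]; first by rewrite nrm0.
  rewrite yS tS nrmZ ger0_norm ?invr_ge0 // ler_wpM2l ?invr_ge0 //.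
  apply: le_trans (nrmD _ _) _; apply: lerD => //.
  apply: le_trans (nrmM _ _) _; have := nrm_ge0 (y n); nra.
have sqB (a b : B) : nrm (a * a - b * b) <= nrm (a - b) * (nrm a + nrm b).
  have -> : a * a - b * b = a * (a - b) + (a - b) * b.
    by rewrite mulrBr mulrBl addrA subrK.
  by apply: le_trans (nrmD _ _) _; have := nrmM a (a - b); have := nrmM (a - b) b; lra.
have half_step (a b : B) : 2^-1 *r (x + a) - 2^-1 *r (x + b) = 2^-1 *r (a - b).
  by rewrite -scalerBr opprD addrACA subrr add0r.
have yB n : nrm (y n.+1 - y n) <= t n.+1 - t n.
  elim: n => [|n IH].
    by rewrite yS tS /= mulr0 addr0 !subr0 expr0n addr0 nrmZ ger0_norm ?invr_ge0 // ler_wpM2l ?invr_ge0.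
  have -> : y n.+2 - y n.+1 = 2^-1 *r (y n.+1 * y n.+1 - y n * y n) by exact: half_step.
  have -> : t n.+2 - t n.+1 = 2^-1 * ((t n.+1 - t n) * (t n.+1 + t n)).
    by rewrite (tS n.+1) [in X in _ - X]tS -subr_sqr -mulrBr opprD addrACA subrr add0r.
  rewrite nrmZ ger0_norm ?invr_ge0 // ler_wpM2l ?invr_ge0 //.
  apply: le_trans (sqB _ _) _.
  have := yt n; have := yt n.+1; have := nrm_ge0 (y n); have := nrm_ge0 (y n.+1).
  have := nrm_ge0 (y n.+1 - y n); nra.
have [l yl] := majorant_lim (fun n => proj2 (andP (tM n))) yB.
have near e : 0 < e -> exists n, nrm (l - y n) <= e /\ nrm (l - y n.+1) <= e.
  by move=> e0; have [N lN] := yl e e0; exists N; split; apply: lN.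
have l1 : nrm l <= 1.
  apply/ler_addgt0Pr => e /near[n [ln _]].
  rewrite -(subrK (y n) l); apply: le_trans (nrmD _ _) _.
  by have := yt n; have /andP[] := tM n; lra.
have lx : l = 2^-1 *r (x + l * l).
  apply/eqP; rewrite -subr_eq0; apply/eqP; apply: (@nrm_eps0 _ _ 2) => e /near[n [ln lSn]].
  apply: le_trans (nrm_split (y n.+1) _ _) _; rewrite yS half_step.
  rewrite nrmZ ger0_norm ?invr_ge0 //.
  have := sqB (y n) l; rewrite [nrm (y n - l)]nrmBC.
  have := nrm_ge0 (l - y n); have := yt n; have /andP[] := tM n.
  have := nrm_ge0 (y n); have := nrm_ge0 l; nra.
exists l; split=> //.
- apply/eqP; rewrite -subr_eq0; apply/eqP; apply: (@nrm_eps0 _ _ 2) => e /near[n [ln _]].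
  have sy : star (y n) = y n.
    by elim: (n) => [|k IH]; rewrite ?star0 // yS star_rsc starD sx starM IH.
  apply: le_trans (nrm_split (y n) _ _) _.
  by rewrite -{1}sy -starB nrm_star [nrm (y n - l)]nrmBC; lra.
- have -> : 1 - x = 1 - l *+ 2 + l * l.
    rewrite {1}lx -rsc_nat rscA divff ?pnatr_eq0 // rsc1.
    by rewrite opprD addrA subrK.
  by rewrite mulrBl mul1r mulrBr mulr1 opprB addrA addrAC mulr2n opprD !addrA.
- move=> c cx.
  have cy n : c * y n = y n * c.
    elim: n => [|n IH]; first by rewrite mulr0 mul0r.
    by rewrite yS rscMl rscMr mulrDr mulrDl cx mulrA IH -!mulrA IH.
  apply/eqP; rewrite -subr_eq0; apply/eqP; apply: (@nrm_eps0 _ _ (2 * nrm c)) => e /near[n [ln _]].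
  apply: le_trans (nrm_split (c * y n) _ _) _; rewrite {2}cy -mulrBl -mulrBr.
  have := nrmM c (l - y n); have := nrmM (y n - l) c; rewrite [nrm (y n - l)]nrmBC.
  have := nrm_ge0 (l - y n); have := nrm_ge0 c; nra.
Qed.

Lemma psd_sqrt b : psd b ->
  exists z, [/\ psd z, z * z = b & forall c, c * b = b * c -> c * z = z * c].
Proof.
move=> pb; have [sb _] := pb; have [t0 bt] := psd_large pb.
pose t := `|t0| + 1.
have t_gt0 : 0 < t by rewrite ltr_wpDl.
have {}bt : nrm (t *r 1 - b) <= t by apply: bt; have := ler_norm t0; rewrite /t; lra.
pose x : B := t^-1 *r (t *r 1 - b).
have sx : star x = x by rewrite star_rsc starB star_rsc star1 sb.
have bx : b = t *r (1 - x).
  by rewrite scalerBr rscA divff ?gt_eqF // rsc1 opprB addrC subrK.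
have x1 : nrm x <= 1.
  by rewrite nrmZ gtr0_norm ?invr_gt0 // ler_pdivrMl // mulr1.
have [y [sy y1 yy cy]] := sqrt_one_minus sx x1.
exists (Num.sqrt t *r (1 - y)); split.
- apply: psdZ; first exact: sqrtr_ge0.
  by have := psd_scalarB sy y1; rewrite rsc1.
- by rewrite rscMl rscMr yy rscA -expr2 sqr_sqrtr ?(ltW t_gt0).
- move=> c cb; rewrite rscMl rscMr mulrBr mulrBl mulr1 mul1r cy //.
  by rewrite rscMl rscMr mulrBr mulrBl rscMl rscMr mulr1 mul1r cb.
Qed.

(** u = z + i w satisfies u^* u = m, and 2 i w = u - u^*, so |w| <= |u|. This
    replaces the spectral theorem in psd_sq and psd_norm_le. *)
Lemma circle_bound z w m : 0 <= m -> star z = z -> star w = w ->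
  z * w = w * z -> z * z + w * w = m *r 1 -> nrm w ^+ 2 <= m.
Proof.
move=> m0 sz sw zw zwm; pose u : B := z + 'i *: w.
have su : star u = z - 'i *: w by rewrite starD starZ sz sw conjCi scaleNr.
have uu : star u * u = m *r 1.
  rewrite su mulrBl !mulrDr -!scalerAl -!scalerAr scalerA -['i * 'i]expr2 sqrCi scaleN1r zw.
  by rewrite -zwm opprB [_ - 'i *: _]addrC addrA addrK.
have nu : nrm u ^+ 2 = m by rewrite -nrmS uu nrm_rsc1 ger0_norm.
have nw : 2 * nrm w <= 2 * nrm u.
  have -> : 2 * nrm w = nrm (u - star u).
    have -> : u - star u = 2 *r ('i *: w).
      by rewrite su rsc_nat mulr2n opprB addrC addrA subrK.
    by rewrite nrmZ ger0_norm // nrm_unimodular // normCi.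
  by apply: le_trans (nrmB _ _) _; rewrite nrm_star; lra.
by rewrite -nu; have := nrm_ge0 w; nra.
Qed.

(** With w a square root of |z|^2 - z^2 commuting with z, circle_bound gives
    | |z|^2 - z^2 | = |w|^2 <= |z|^2. *)
Lemma psd_sq z : star z = z -> psd (z * z).
Proof.
move=> sz; split; first by rewrite starM sz.
have pw : psd (nrm z ^+ 2 *r 1 - z * z).
  by apply: psd_scalarB; rewrite ?starM ?sz ?nrm_sq.
have [w [[sw _] ww cw]] := psd_sqrt pw.
exists (nrm z ^+ 2); rewrite -ww nrm_sq //.
apply: (@circle_bound z) => //; first exact: exprn_ge0 (nrm_ge0 _).
  apply: cw; rewrite mulrBr mulrBl rscMl rscMr mulr1 mul1r mulrA //.
by rewrite ww addrC subrK.
Qed.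

Lemma psd_mul_comm x y : psd x -> psd y -> x * y = y * x -> psd (x * y).
Proof.
move=> px py xy; have [z [[sz _] zz cz]] := psd_sqrt px.
have [w [[sw _] ww cw]] := psd_sqrt py.
have yz : y * z = z * y by apply: cz.
have zw : z * w = w * z by apply: cw; rewrite yz.
have -> : x * y = (z * w) * (z * w) by rewrite -zz -ww -!mulrA (mulrA w z w) -zw !mulrA.
by apply: psd_sq; rewrite starM sz sw zw.
Qed.

(** Monotonicity of the norm, again from circle_bound applied to square roots of
    x and of M - x. *)
Lemma psd_norm_le M x : 0 <= M -> psd x -> psd (M *r 1 - x) -> nrm x <= M.
Proof.
move=> M0 px pMx; have [w [[sw _] ww cw]] := psd_sqrt px.
have [z [[sz _] zz cz]] := psd_sqrt pMx.
have xz : x * z = z * x.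
  by apply: cz; rewrite mulrBr mulrBl rscMl rscMr mulr1 mul1r.
rewrite -ww nrm_sq //; apply: (@circle_bound z) => //.
  by apply: cw.
by rewrite ww zz subrK.
Qed.

End Order.

Section Positive.
Variables (R : realType) (B : unitalCstar R).
Implicit Types (x y z c w : B) (r s t d m : R).

(** Twice the sum is the sum of the squares of c + c^* and of i (c - c^* ). *)
Lemma psd_starM_starMr c : psd (star c * c + c * star c).
Proof.
have -> : star c * c + c * star c = 2^-1 *r
    ((c + star c) * (c + star c) + ('i *: (c - star c)) * ('i *: (c - star c))).
  rewrite -scalerAl -scalerAr scalerA -['i * 'i]expr2 sqrCi scaleN1r.
  rewrite !mulrDl !mulrDr !mulNr !mulrN.
  by linear_identity; field.
apply: psdZ; first by rewrite invr_ge0.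
apply: psdD; apply: psd_sq; first by rewrite starD starK addrC.
by rewrite starZ conjCi scaleNr -scalerN starB starK opprB.
Qed.

(** The Kelley-Vaught theorem. Put b = c^* c, a = |b| and y = a - b, which is twice
    the negative part of b, and test on d = c y. Then d^* d = y b y = - g with
    g = a y^2 positive, whereas k = d d^* is positive because d^* d + d d^* is. Let
    m = |d|^2 = |g| = |k|. On the one hand |k (m - k)| <= m^2 / 4; on the other
    d^* (k (m - k)) d = m g^2 + g^3, whose norm is at least |m g^2| = m^3. Hence
    m^3 <= m^3 / 4, so g = 0, which forces y = 0 and b = |b|. *)
Lemma psd_starM c : psd (star c * c).
Proof.
set b := star c * c.
have sb : star b = b by rewrite starM starK.
have [a [pa aa ca]] := psd_sqrt (psd_sq sb); have [sa _] := pa.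
have ab : a * b = b * a by symmetry; apply: ca; rewrite mulrA.
pose y := a - b; pose g := a * (y * y).
have sy : star y = y by rewrite starB sa sb.
have ay : a * y = y * a by rewrite mulrBr mulrBl ab.
have by_ : b * y = y * b by rewrite mulrBr mulrBl ab.
have yb : y * b = - (a * y) by rewrite -by_ mulrBr mulrBr -aa -ab opprB.
have yy : y * y = 2 *r (a * y).
  by rewrite [LHS]mulrBl by_ yb opprK rsc_nat mulr2n.
have pg : psd g by apply: psd_mul_comm => //; [exact: psd_sq|rewrite mulrA ay -!mulrA ay].
have [sg _] := pg.
(* d only sees the part of c on which b is negative, since y kills the rest. *)
pose d := c * y; pose m := nrm d ^+ 2; have m0 : 0 <= m by exact/exprn_ge0/nrm_ge0.
have dd : star d * d = - g.
  by rewrite starM sy -mulrA (mulrA (star c)) -/b mulrA yb mulNr -mulrA.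
pose k := d * star d; have sk : star k = k by rewrite starM starK.
have pk : psd k.
  have -> : k = (star d * d + d * star d) + g by rewrite dd -/k; linear_identity; ring.
  by apply: psdD => //; exact: psd_starM_starMr.
have nk : nrm k = m by rewrite nrmSr.
have ng : nrm g = m by rewrite -nrmN -dd nrmS.
pose X := k * (m *r 1 - k).
have kX : X = m *r k - k * k by rewrite /X mulrBr rscMr mulr1.
have nX : nrm X <= m ^+ 2 / 4.
  apply: psd_norm_le; first by apply: divr_ge0 => //; exact: exprn_ge0.
    apply: psd_mul_comm => //; first by apply: psd_scalarB; rewrite ?nk.
    by rewrite mulrBr mulrBl rscMl rscMr mulr1 mul1r.
  have -> : (m ^+ 2 / 4) *r 1 - X = ((m / 2) *r 1 - k) * ((m / 2) *r 1 - k).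
    rewrite kX !mulrBl !mulrBr !rscMl !rscMr !mulr1 !mul1r.
    by linear_identity; field.
  by apply: psd_sq; rewrite starB star_rsc star1 sk.
have gg : psd (g * g) by apply: psd_sq.
have ggg : psd (g * (g * g)) by apply: psd_mul_comm => //; rewrite mulrA.
have dX : star d * X * d = m *r (g * g) + g * (g * g).
  have dk : star d * k = - g * star d by rewrite /k mulrA dd.
  have kd : k * d = d * - g by rewrite /k -mulrA dd.
  have kkd : star d * (k * k) * d = - (g * (g * g)).
    have -> : star d * (k * k) * d = (star d * k) * (k * d) by rewrite !mulrA.
    by rewrite dk kd -mulrA (mulrA (star d)) dd mulrNN mulNr.
  have skd : star d * k * d = g * g by rewrite dk -mulrA dd mulrNN.
  by rewrite kX mulrBr rscMr mulrBl rscMl kkd skd opprK.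
have m3 : m * m ^+ 2 <= m ^+ 3 / 4.
  have -> : m * m ^+ 2 = nrm (m *r (g * g)) by rewrite nrmZ ger0_norm // nrm_sq // ng.
  apply: (@le_trans _ _ (nrm (m *r (g * g) + g * (g * g)))).
    apply: psd_norm_le; [exact: nrm_ge0|exact: psdZ|].
    have -> (Z := m *r (g * g) + g * (g * g)) :
        nrm Z *r 1 - m *r (g * g) = (nrm Z *r 1 - Z) + g * (g * g).
      by rewrite /Z; linear_identity; ring.
    apply: psdD => //; apply: psd_scalarB => //; exact: (proj1 (psdD (psdZ m0 gg) ggg)).
  rewrite -dX; apply: le_trans (nrmM _ _) _.
  have := nrmM (star d) X; rewrite nrm_star; have := nrm_ge0 d; have := nrm_ge0 X.
  rewrite -/m in nX *; move: nX; rewrite /m; nra.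
have {m3} mz : m = 0.
  apply: le_anti; rewrite m0 andbT leNgt; apply/negP => mp.
  by have := exprn_gt0 3 mp; rewrite -exprS in m3; lra.
have gz : g = 0 by apply: nrm_eq0; rewrite ng mz.
have sq0 v : star v = v -> v * v = 0 -> v = 0.
  move=> sv vv; apply: nrm_eq0; apply/eqP.
  by rewrite -sqrf_eq0 -nrm_sq // vv nrm0.
have yz : y = 0.
  apply: (sq0 _) => //; apply: (sq0 _); first by rewrite starM sy.
  by rewrite {1}yy rscMl -mulrA (mulrA y) mulrA -/g gz mul0r scaler0.
by have -> : b = a by apply/eqP; rewrite eq_sym -subr_eq0 -/y yz.
Qed.

Lemma psd_conj y x : psd x -> psd (star y * x * y).
Proof.
move=> /psd_sqrt[z [[sz _] <- _]].
have -> : star y * (z * z) * y = star (z * y) * (z * y).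
  by rewrite starM sz !mulrA.
exact: psd_starM.
Qed.

Lemma psd_cstar_pos x : psd x <-> cstar_pos x.
Proof.
split=> [/psd_sqrt[z [[sz _] <- _]]|[c ->]]; last exact: psd_starM.
by exists z; rewrite sz.
Qed.

Lemma psd_invertible w d : 0 < d -> psd (w - d *r 1) -> invertible w.
Proof.
move=> d0 [_ [t]]; set v := t *r 1 - _ => vt.
have t0 : 0 <= t := le_trans (nrm_ge0 _) vt.
have td : 0 < t + d by rewrite ltr_wpDl.
have [] := @invertible_near1 _ _ ((t + d)^-1 *r v).
  by rewrite nrmZ gtr0_norm ?invr_gt0 // ltr_pdivrMl // mulr1; lra.
move=> l [vl lv].
have wE : w = (t + d) *r (1 - (t + d)^-1 *r v).
  by rewrite /v; linear_identity; field; rewrite gt_eqF.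
exists ((t + d)^-1 *r l); rewrite wE !rscMl !rscMr vl lv !rscA.
by rewrite mulVf ?mulfV ?gt_eqF // rsc1.
Qed.

Lemma psd_inverse w w' : psd w -> w * w' = 1 -> w' * w = 1 -> psd w'.
Proof.
move=> pw ww' w'w; have [sw _] := pw.
have sw' : star w' * w = 1 by rewrite -{1}sw -starM ww' star1.
have {}sw' : star w' = w' by rewrite -[LHS]mulr1 -ww' mulrA sw' mul1r.
by rewrite -[w']mul1r -w'w -{1}sw'; exact: psd_conj.
Qed.

(** Both conditions express |x|^2 <= m. *)
Lemma psd_swap m x : 0 <= m -> psd (m *r 1 - star x * x) -> psd (m *r 1 - x * star x).
Proof.
move=> m0 le; have := psd_norm_le m0 (psd_starM x) le; rewrite nrmS => xm.
by apply: psd_scalarB; rewrite ?starM ?starK // nrmSr.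
Qed.

(** With z the square root of w, the hypothesis conjugated by z reads
    (c z)^* (c z) <= 1; swapping the factors gives c w c^* <= 1, which is then
    conjugated by c'. *)
Lemma inverse_antitone_ge w w' c c' : psd w -> w * w' = 1 -> w' * w = 1 ->
  c * c' = 1 -> c' * c = 1 ->
  psd (w' - star c * c) -> psd (c' * star c' - w).
Proof.
move=> pw ww' w'w cc' c'c le; have [z [[sz _] zz cz]] := psd_sqrt pw.
have zw : z * w = w * z by rewrite -zz mulrA.
have zw'z : z * w' * z = 1.
  have zw' : z * w' = w' * z by rewrite -[LHS]mul1r -w'w -mulrA (mulrA w) -zw -!mulrA ww' mulr1.
  by rewrite zw' -mulrA zz w'w.
have le1 : psd (1 *r 1 - star (c * z) * (c * z)).
  have := psd_conj z le; rewrite sz mulrBr mulrBl zw'z rsc1.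
  by rewrite starM sz !mulrA.
have := psd_conj (star c') (psd_swap ler01 le1).
rewrite starK rsc1 mulrBr mulrBl mulr1 starM sz.
have -> : c' * (c * z * (z * star c)) * star c' = w * (star c * star c').
  by rewrite -(mulrA c) (mulrA z) zz !mulrA c'c mul1r.
by rewrite -starM c'c star1 mulr1.
Qed.

(** Dual to inverse_antitone_ge: conjugate by c', swap the factors of v c' for v
    the square root of w', and undo v with w v, the inverse of v. *)
Lemma inverse_antitone_le m w w' c c' : 0 <= m -> psd w -> w * w' = 1 -> w' * w = 1 ->
  c * c' = 1 -> c' * c = 1 ->
  psd (m *r (star c * c) - w') -> psd (m *r w - c' * star c').
Proof.
move=> m0 pw ww' w'w cc' c'c le.
have [v [[sv _] vv cv]] := psd_sqrt (psd_inverse pw ww' w'w).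
have vw : v * w = w * v.
  have vw' : v * w' = w' * v by rewrite -vv mulrA.
  by rewrite -[LHS]mul1r -ww' -mulrA (mulrA w') -vw' -!mulrA w'w mulr1.
have vwv : v * w * v = 1 by rewrite vw -mulrA vv ww'.
have scc : star c' * star c = 1 by rewrite -starM cc' star1.
have le1 : psd (m *r 1 - star (v * c') * (v * c')).
  have := psd_conj c' le; rewrite mulrBr mulrBl rscMr rscMl.
  have -> : star c' * (star c * c) * c' = 1 by rewrite mulrA scc mul1r cc'.
  by rewrite starM sv -vv !mulrA.
have := psd_conj (w * v) (psd_swap m0 le1).
have [sw _] := pw.
rewrite starM sv sw mulrBr mulrBl rscMr rscMl mulr1.
have -> : v * w * (w * v) = w by rewrite vw -mulrA (mulrA v) vwv mulr1.
have -> : v * w * (v * c' * star (v * c')) * (w * v) = c' * star c'.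
  transitivity ((v * w * v) * (c' * star c') * (v * w * v)).
    by rewrite starM sv !mulrA.
  by rewrite vwv mul1r mulr1.
by [].
Qed.

End Positive.

Section CartesianParts.
Variables (R : realType) (B : unitalCstar R).
Implicit Types (u v w : B) (r : R).

Definition re_part w : B := 2^-1 *r (w + star w).
(** Defined through re_part so that facts about real parts apply to it directly. *)
Definition im_part w : B := re_part (- 'i *: w).

Lemma re_part_sa w : star (re_part w) = re_part w.
Proof. by rewrite star_rsc starD starK addrC. Qed.

Lemma re_partD v w : re_part (v + w) = re_part v + re_part w.
Proof. by rewrite /re_part starD; linear_identity; ring. Qed.

Lemma re_part_rsc r w : re_part (r *r w) = r *r re_part w.
Proof. by rewrite /re_part star_rsc; linear_identity; ring. Qed.

Lemma re_partN w : re_part (- w) = - re_part w.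
Proof. by rewrite /re_part starN; linear_identity; ring. Qed.

Lemma re_part_id u : star u = u -> re_part u = u.
Proof. by move=> su; rewrite /re_part su; linear_identity; field. Qed.

Lemma im_part_sa w : star (im_part w) = im_part w.
Proof. exact: re_part_sa. Qed.

Lemma im_partD v w : im_part (v + w) = im_part v + im_part w.
Proof. by rewrite /im_part scalerDr re_partD. Qed.

Lemma im_part_rsc r w : im_part (r *r w) = r *r im_part w.
Proof. by rewrite /im_part scalerA mulrC -scalerA re_part_rsc. Qed.

Lemma re_part_i w : re_part ('i *: w) = - im_part w.
Proof. by rewrite /im_part scaleNr re_partN opprK. Qed.

Lemma im_part_i w : im_part ('i *: w) = re_part w.
Proof. by rewrite /im_part scalerA mulNr -expr2 sqrCi opprK scale1r. Qed.

Lemma im_part_eq0 u : star u = u -> im_part u = 0.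
Proof.
move=> su; rewrite /im_part /re_part starZ su rmorphN /= conjCi opprK scaleNr.
by rewrite addNr scaler0.
Qed.

Lemma cartesian w : w = re_part w + 'i *: im_part w.
Proof.
have i2 : 'i * 'i = -1 :> R[i] by rewrite -expr2 sqrCi.
have -> : 'i *: im_part w = 2^-1 *r (w - star w).
  rewrite /im_part /re_part starZ rmorphN /= conjCi opprK scalerA mulrC -scalerA.
  by rewrite scalerDr !scalerA mulrN i2 opprK scale1r scaleN1r.
by rewrite /re_part; linear_identity; field.
Qed.

End CartesianParts.

(** * Operators on a Hilbert space *)

Section Forms.
Variables (R : realType) (H : hilbertType R).
Implicit Types (x y z : H) (c : R[i]) (r : R) (q : H -> R[i]) (S T : bop H).

Lemma ceps0 (w : R[i]) (K : R) : (forall e : R, 0 < e -> `|w| <= (K * e)%:C%C) -> w = 0.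
Proof.
move=> wK; apply/eqP; rewrite -normr_eq0; apply/eqP.
have wE : (complex.Re `|w|)%:C%C = `|w| by rewrite RRe_real // normr_real.
have : complex.Re `|w| <= 0 by apply: (@le0_eps _ K) => e /wK; rewrite -wE lecR.
by rewrite -lecR wE => w0; apply/eqP; rewrite eq_le w0 normr_ge0.
Qed.

Lemma rparallelogram x y :
  rnorm (x + y) ^+ 2 + rnorm (x - y) ^+ 2 = 2 * (rnorm x ^+ 2 + rnorm y ^+ 2).
Proof.
apply: complexI.
rewrite [LHS]rmorphD [RHS]rmorphM [X in _ = _ * X]rmorphD !rmorphXn /= !rnormE parallelogram.
by rewrite (rmorph_nat (real_complex R)).
Qed.

Lemma rnormZ r x : rnorm (r *r x) = `|r| * rnorm x.
Proof.
apply: complexI; rewrite rmorphM /= !rnormE normrZ.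
by rewrite norm_real_complex.
Qed.

Lemma rnorm_eq0 x : rnorm x = 0 -> x = 0.
Proof. by move=> x0; apply/eqP; rewrite -normr_eq0 -rnormE x0. Qed.

Definition polar q x y : R[i] :=
  4^-1 * (q (x + y) - q (x - y) + 'i * q (x + 'i *: y) - 'i * q (x - 'i *: y)).

Lemma polar_bop T x y : hdot (T x) y = polar (fun x => hdot (T x) x) x y.
Proof.
have i2 : 'i * 'i = -1 :> R[i] by rewrite -expr2 sqrCi.
rewrite /polar !(linearD T, linearN T, linearZ_LR T) /=.
rewrite !(hdotDl, hdotDr, hdotNl, hdotNr, hdotZl, hdotZr) conjCi.
move: (hdot (T x) x) (hdot (T x) y) (hdot (T y) x) (hdot (T y) y) i2.
move: ('i : R[i]) => i a b c d i2.
by field: i2.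
Qed.

Lemma bop_eq0 T : (forall x, hdot (T x) x = 0) -> T = 0.
Proof.
move=> T0; apply: bopP => x; apply: hdot_ext => y.
rewrite hdotC polar_bop /polar !T0 !(mulr0, subr0, addr0) conjC0.
by rewrite hdot0r.
Qed.

Lemma bop_ext (S T : bop H) : (forall x, hdot (S x) x = hdot (T x) x) -> S = T.
Proof.
move=> ST; apply/eqP; rewrite -subr_eq0; apply/eqP; apply: bop_eq0 => x.
by rewrite /= hdotDl hdotNl ST subrr.
Qed.

(** The polarization s of q is approximated by the sesquilinear forms of the
    operators T, hence is itself sesquilinear. It is bounded because its distance
    to the form of a single operator T1 is at most |x|^2 + |y|^2, which by scaling
    y improves to 2 |x| |y|. Riesz representation then produces the operator. *)
Lemma quad_form_limit q :
  (forall e : R, 0 < e -> exists T, forall x,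
     `|q x - hdot (T x) x| <= (e * rnorm x ^+ 2)%:C%C) ->
  exists T, forall x, q x = hdot (T x) x.
Proof.
move=> qT; pose s := polar q.
have sT (e : R) : 0 < e -> exists T,
    (forall x, `|q x - hdot (T x) x| <= (e * rnorm x ^+ 2)%:C%C) /\
    (forall x y, `|s x y - hdot (T x) y| <= (e * (rnorm x ^+ 2 + rnorm y ^+ 2))%:C%C).
  move=> /qT[T Tq]; exists T; split=> // x y; rewrite polar_bop /s /polar -mulrBr normrM.
  have -> : `|4^-1 : R[i]| = 4^-1 by rewrite ger0_norm // invr_ge0.
  rewrite mulrC ler_pdivrMr //.
  set w := _ - _.
  have -> : w = (q (x + y) - hdot (T (x + y)) (x + y))
     - (q (x - y) - hdot (T (x - y)) (x - y))
     + 'i * (q (x + 'i *: y) - hdot (T (x + 'i *: y)) (x + 'i *: y))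
     - 'i * (q (x - 'i *: y) - hdot (T (x - 'i *: y)) (x - 'i *: y)).
    by rewrite /w; ring.
  apply: le_trans (ler_normB _ _) _; rewrite normrM normCi mul1r.
  apply: le_trans (lerD (ler_normD _ _) (Tq _)) _; rewrite normrM normCi mul1r.
  apply: le_trans (lerD (lerD (ler_normB _ _) (Tq _)) (lexx _)) _.
  apply: le_trans (lerD (lerD (lerD (Tq _) (Tq _)) (lexx _)) (lexx _)) _.
  have nI : rnorm ('i *: y) = rnorm y by rewrite /rnorm normrZ normCi mul1r.
  have -> : (4 : R[i]) = (4 : R)%:C%C by rewrite (rmorph_nat (real_complex R)).
  rewrite -!rmorphD -rmorphM lecR.
  have p1 := rparallelogram x y; have := rparallelogram x ('i *: y); rewrite nI => p2.
  by rewrite -!mulrDr -addrA p2 p1; nra.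
have sl c x z y : s (c *: x + z) y = c * s x y + s z y.
  apply/eqP; rewrite -subr_eq0; apply/eqP.
  apply: (@ceps0 _ ((rnorm (c *: x + z) ^+ 2 + rnorm y ^+ 2) +
    complex.Re `|c| * (rnorm x ^+ 2 + rnorm y ^+ 2) + (rnorm z ^+ 2 + rnorm y ^+ 2))) => e /sT[T [_ Ts]].
  have -> : s (c *: x + z) y - (c * s x y + s z y) =
     (s (c *: x + z) y - hdot (T (c *: x + z)) y)
     - c * (s x y - hdot (T x) y) - (s z y - hdot (T z) y).
    by rewrite (bop_linear T) hdotDl hdotZl; ring.
  apply: le_trans (ler_normB _ _) _; apply: le_trans (lerD (ler_normB _ _) (Ts _ _)) _.
  rewrite normrM mulrDl rmorphD lerD // ?(mulrC (_ + _)) //.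
  rewrite mulrDr rmorphD lerD //.
  by rewrite mulrCA rmorphM ler_pM // RRe_real // normr_real.
have sr c x y z : s x (c *: y + z) = c^* * s x y + s x z.
  apply/eqP; rewrite -subr_eq0; apply/eqP.
  apply: (@ceps0 _ ((rnorm x ^+ 2 + rnorm (c *: y + z) ^+ 2) +
    complex.Re `|c| * (rnorm x ^+ 2 + rnorm y ^+ 2) + (rnorm x ^+ 2 + rnorm z ^+ 2))) => e /sT[T [_ Ts]].
  have -> : s x (c *: y + z) - (c^* * s x y + s x z) =
     (s x (c *: y + z) - hdot (T x) (c *: y + z))
     - c^* * (s x y - hdot (T x) y) - (s x z - hdot (T x) z).
    by rewrite hdotDr hdotZr; ring.
  apply: le_trans (ler_normB _ _) _; apply: le_trans (lerD (ler_normB _ _) (Ts _ _)) _.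
  rewrite normrM norm_conjC mulrDl rmorphD lerD // ?(mulrC (_ + _)) //.
  rewrite mulrDr rmorphD lerD //.
  by rewrite mulrCA rmorphM ler_pM // RRe_real // normr_real.
have s0r x : s x 0 = 0.
  have := sr 1 x 0 0; rewrite scaler0 addr0 conjC1 mul1r => /eqP.
  by rewrite -subr_eq0 opprD addNKr oppr_eq0 => /eqP.
have s0l y : s 0 y = 0.
  have := sl 1 0 0 y; rewrite scaler0 addr0 mul1r => /eqP.
  by rewrite -subr_eq0 opprD addNKr oppr_eq0 => /eqP.
have [T1 [_ T1s]] := sT 1 ltr01.
have [N N0 T1N] := bop_bounded T1.
pose g x y := s x y - hdot (T1 x) y.
have gr r x y : g x (r *r y) = r%:C%C * g x y.
  have := sr r%:C%C x y 0; rewrite addr0 s0r addr0 => sry.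
  by rewrite /g sry hdotZr conj_real_complex mulrBr.
have gb x y : `|g x y| <= (2 * rnorm x * rnorm y)%:C%C.
  have [->|y0] := eqVneq y 0.
    by rewrite /g s0r hdot0r subrr normr0 ler0c !mulr_ge0 ?rnorm_ge0.
  have [->|x0] := eqVneq x 0.
    by rewrite /g s0l linear0 hdot0l subrr normr0 ler0c !mulr_ge0 ?rnorm_ge0.
  have ny : 0 < rnorm y.
    by rewrite lt_def rnorm_ge0 andbT; apply: contra_neq y0; exact: rnorm_eq0.
  have nx : 0 < rnorm x.
    by rewrite lt_def rnorm_ge0 andbT; apply: contra_neq x0; exact: rnorm_eq0.
  have r0 : 0 < rnorm x / rnorm y by rewrite divr_gt0.
  (* Rescaling y to the norm of x makes the two terms of the bound equal. *)
  have := T1s x ((rnorm x / rnorm y) *r y); rewrite -/(g _ _) gr normrM mul1r rnormZ.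
  rewrite (gtr0_norm r0) divfK ?gt_eqF // ger0_norm ?ler0c ?(ltW r0) //.
  rewrite mulrC -ler_pdivlMr ?ltcR // => /le_trans; apply; rewrite -fmorphV -rmorphM lecR.
  have -> : (rnorm x ^+ 2 + rnorm x ^+ 2) / (rnorm x / rnorm y) = 2 * rnorm x * rnorm y.
    by field; rewrite !gt_eqF.
  exact: lexx.
have sb x y : `|s x y| <= ((N + 2) * rnorm x)%:C%C * `|y|.
  have -> : s x y = hdot (T1 x) y + g x y by rewrite /g addrC subrK.
  apply: le_trans (ler_normD _ _) _; apply: le_trans (lerD (hdot_CS _ _) (gb _ _)) _.
  rewrite -!rnormE -!rmorphM -rmorphD lecR.
  have := T1N x; rewrite -!rnormE -rmorphM lecR => T1x.
  have := rnorm_ge0 y; nra.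
have rz x : exists v, forall y, (s x y)^* = hdot y v.
  apply: (@riesz R H _ ((N + 2) * rnorm x)) => [c u v|y].
    by rewrite sr rmorphD rmorphM /= conjCK.
  by rewrite norm_conjC.
have [V Vs] := choice rz.
have {}Vs x y : hdot (V x) y = s x y by rewrite hdotC -Vs conjCK.
have Vb : V \in bounded_op (H := H).
  apply/bounded_opP; split.
    move=> c x z; apply: hdot_ext => y.
    rewrite hdotC [RHS]hdotC; congr (_ ^*).
    by rewrite hdotDl hdotZl !Vs sl.
  exists (N + 2) => [|x]; first by rewrite addr_ge0.
  have [->|Vx0] := eqVneq (V x) 0; first by rewrite normr0 mulr_ge0 // ler0c addr_ge0.
  have Vx : 0 < `|V x| by rewrite normr_gt0.
  rewrite -(ler_pM2r Vx) -expr2 -hdot_norm Vs.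
  have := sb x (V x); rewrite (rmorphM (real_complex R)) /= rnormE; apply: le_trans.
  by rewrite -Vs hdot_norm normrX normr_id.
exists (Bop Vb) => x /=; rewrite Vs.
apply/eqP; rewrite -subr_eq0; apply/eqP.
apply: (@ceps0 _ (3 * rnorm x ^+ 2)) => e /sT[T [Tq Ts]].
have -> : q x - s x x = (q x - hdot (T x) x) - (s x x - hdot (T x) x) by ring.
apply: le_trans (ler_normB _ _) _; apply: le_trans (lerD (Tq _) (Ts _ _)) _.
by rewrite -rmorphD lecR; lra.
Qed.

End Forms.

Section Adjoint.
Variables (R : realType) (H : hilbertType R).
Implicit Types (X Y : bop H) (x y h : H).

Lemma adjointM X Y : adjoint (X * Y) = adjoint Y * adjoint X.
Proof. by apply: bopP => x; apply: hdot_ext => y; rewrite /= -!adjointE. Qed.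

Lemma adjoint1 : adjoint (1 : bop H) = 1.
Proof. by apply: bopP => x; apply: hdot_ext => y; rewrite /= -!adjointE. Qed.

Lemma adjoint_rsc r X : adjoint (r *r X) = r *r adjoint X.
Proof.
apply: bopP => x; apply: hdot_ext => y; rewrite -adjointE /= hdotZl hdotZr -adjointE.
by rewrite conj_real_complex.
Qed.

Lemma hdotE x : hdot x x = (rnorm x ^+ 2)%:C%C.
Proof. by rewrite hdot_norm rmorphXn /= rnormE. Qed.

Lemma rnorm_sqD x h t :
  rnorm (x + t *r h) ^+ 2 = rnorm x ^+ 2 + 2 * t * complex.Re (hdot h x) + t ^+ 2 * rnorm h ^+ 2.
Proof.
have conjD (z : R[i]) : z + z^* = (2 * complex.Re z)%:C%C.
  by case: z => p q; apply/eqP; rewrite eq_complex /= addrN mulr2n mulrDl !mul1r !eqxx.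
apply: complexI; rewrite -hdotE !hdotDl !hdotDr !hdotZl !hdotZr !hdotE conj_real_complex (hdotC x h).
have -> : (rnorm x ^+ 2 + 2 * t * complex.Re (hdot h x) + t ^+ 2 * rnorm h ^+ 2)%:C%C =
    (rnorm x ^+ 2)%:C%C + t%:C%C * (hdot h x + (hdot h x)^*) + t%:C%C * t%:C%C * (rnorm h ^+ 2)%:C%C.
  by rewrite conjD -!rmorphM -!rmorphD; congr (_%:C%C); ring.
by ring.
Qed.

Lemma hsum_norm_ge0 n (k : 'I_n -> H) : 0 <= hsum_norm k.
Proof. exact: sqrtr_ge0. Qed.

Lemma hsum_normE n (k : 'I_n -> H) : hsum_norm k ^+ 2 = \sum_j rnorm (k j) ^+ 2.
Proof. by rewrite sqr_sqrtr // sumr_ge0 // => i _; rewrite exprn_ge0 ?rnorm_ge0. Qed.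

Lemma rnorm_le_hsum n (k : 'I_n -> H) j : rnorm (k j) <= hsum_norm k.
Proof.
rewrite -(@ler_pXn2r _ 2) ?nnegrE ?rnorm_ge0 ?hsum_norm_ge0 // hsum_normE.
rewrite (bigD1 j) //= lerDl sumr_ge0 // => i _; by rewrite exprn_ge0 ?rnorm_ge0.
Qed.

Lemma rnorm_sum n (k : 'I_n -> H) : rnorm (\sum_j k j) <= \sum_j rnorm (k j).
Proof.
rewrite -lecR rnormE rmorph_sum /=; apply: le_trans (ler_norm_sum _ _ _) _.
by apply: ler_sum => i _; rewrite rnormE.
Qed.

Lemma bop_rbounded n (T : 'I_n -> bop H) :
  exists2 N : 'I_n -> R, forall j, 0 <= N j & forall j x, rnorm (T j x) <= N j * rnorm x.
Proof.
have /choice[N NT] j : exists N : R, 0 <= N /\ forall x, rnorm (T j x) <= N * rnorm x.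
  have [M M0 TM] := bop_bounded (T j); exists M; split=> // x.
  by rewrite -lecR rmorphM /= !rnormE.
by exists N => j; have [] := NT j.
Qed.

Lemma row_opnorm_ub n (T : 'I_n -> bop H) (k : 'I_n -> H) :
  hsum_norm k <= 1 -> rnorm (\sum_j T j (k j)) <= row_opnorm T.
Proof.
move=> k1; apply: sup_ubound; last by exists k.
have [N N0 TN] := bop_rbounded T; exists (\sum_j N j) => _ [h /= h1 <-].
apply: le_trans (rnorm_sum _) _; apply: ler_sum => j _.
apply: le_trans (TN j _) _; rewrite ler_piMr //.
exact: le_trans (rnorm_le_hsum h j) h1.
Qed.

Lemma col_opnorm_ub n (T : 'I_n -> bop H) (x : H) :
  rnorm x <= 1 -> hsum_norm (fun j => T j x) <= col_opnorm T.
Proof.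
move=> x1; apply: sup_ubound; last by exists x.
have [N N0 TN] := bop_rbounded T; exists (Num.sqrt (\sum_j N j ^+ 2)) => _ [h /= h1 <-].
rewrite ler_sqrt; last by rewrite sumr_ge0 // => j _; rewrite exprn_ge0.
apply: ler_sum => j _; rewrite ler_pXn2r ?nnegrE ?rnorm_ge0 //.
by apply: le_trans (TN j _) _; rewrite ler_piMr.
Qed.

Lemma col_opnorm_bound n (T : 'I_n -> bop H) (K : R) : col_opnorm T <= K ->
  forall x, \sum_j rnorm (T j x) ^+ 2 <= K ^+ 2 * rnorm x ^+ 2.
Proof.
move=> TK x; have [x0|x0] := eqVneq (rnorm x) 0.
  rewrite (rnorm_eq0 x0) big1 => [|j _]; first by apply: mulr_ge0; exact: sqr_ge0.
  by rewrite linear0 /rnorm normr0 expr0n.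
have nx : 0 < rnorm x by rewrite lt_def x0 rnorm_ge0.
have := @col_opnorm_ub n T ((rnorm x)^-1 *r x).
rewrite rnormZ gtr0_norm ?invr_gt0 // mulVf // => /(_ (lexx 1))/le_trans/(_ TK) le1.
have K0 : 0 <= K := le_trans (hsum_norm_ge0 _) le1.
have le2 : hsum_norm (fun j => T j ((rnorm x)^-1 *r x)) ^+ 2 <= K ^+ 2.
  by rewrite ler_pXn2r ?nnegrE ?hsum_norm_ge0 ?K0.
rewrite -ler_pdivrMr ?exprn_gt0 //; apply: le_trans le2; rewrite hsum_normE.
rewrite mulr_suml; apply: ler_sum => j _.
by rewrite linearZ /= rnormZ gtr0_norm ?invr_gt0 // exprMn exprVn mulrC.
Qed.

Lemma row_opnorm_bound n (T : 'I_n -> bop H) (K : R) : row_opnorm T <= K ->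
  forall k : 'I_n -> H, rnorm (\sum_j T j (k j)) <= K * hsum_norm k.
Proof.
move=> TK k; have [k0|k0] := eqVneq (hsum_norm k) 0.
  rewrite k0 mulr0 big1 ?/rnorm ?normr0 // => j _.
  have -> : k j = 0; last by rewrite linear0.
  apply: rnorm_eq0; apply/le_anti; rewrite rnorm_ge0 andbT -k0; exact: rnorm_le_hsum.
have nk : 0 < hsum_norm k by rewrite lt_def k0 hsum_norm_ge0.
have h1 : hsum_norm (fun j => (hsum_norm k)^-1 *r k j) <= 1.
  rewrite -(@ler_pXn2r _ 2) ?nnegrE ?hsum_norm_ge0 // hsum_normE expr1n.
  under eq_bigr do rewrite rnormZ exprMn gtr0_norm ?invr_gt0 //.
  by rewrite -mulr_sumr -hsum_normE -exprMn mulVf ?expr1n.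
have := le_trans (row_opnorm_ub T h1) TK.
under eq_bigr do rewrite linearZ.
rewrite -scaler_sumr rnormZ gtr0_norm ?invr_gt0 // ler_pdivrMl // mulrC //.
Qed.

(** The norm of a row of operators is the norm of the column of the adjoints:
    apply the row to the vectors k j = (T j)^* x and pair with x. *)
Lemma row_opnorm_adjoint_bound n (T : 'I_n -> bop H) (K : R) : row_opnorm T <= K ->
  forall x, \sum_j rnorm (adjoint (T j) x) ^+ 2 <= K ^+ 2 * rnorm x ^+ 2.
Proof.
move=> TK x; pose k j := adjoint (T j) x.
rewrite -(hsum_normE k); have le1 := row_opnorm_bound TK k.
have eQ : hdot (\sum_j T j (k j)) x = (hsum_norm k ^+ 2)%:C%C.
  rewrite hsum_normE rmorph_sum /= (big_morph (hdot^~ x) (fun y z => hdotDl y z x) (hdot0l x)).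
  by apply: eq_bigr => j _; rewrite adjointE hdotE.
have le2 : hsum_norm k ^+ 2 <= K * hsum_norm k * rnorm x.
  apply: le_trans (ler_wpM2r (rnorm_ge0 x) le1).
  rewrite -lecR -eQ rmorphM /= !rnormE; apply: le_trans (hdot_CS _ _).
  by rewrite eQ ger0_norm // ler0c exprn_ge0 ?hsum_norm_ge0.
have [k0|k0] := eqVneq (hsum_norm k) 0; first by rewrite k0 expr0n mulr_ge0 ?sqr_ge0.
have nk : 0 < hsum_norm k by rewrite lt_def k0 hsum_norm_ge0.
have le3 : hsum_norm k <= K * rnorm x by move: le2; rewrite mulrAC expr2 ler_pM2r.
by rewrite -exprMn ler_pXn2r ?nnegrE ?(le_trans (ltW nk)) // ltW.
Qed.

End Adjoint.

Section PositiveMaps.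
Variables (R : realType) (B : unitalCstar R) (H : hilbertType R).
Implicit Types (u v w b : B) (h : H).

(** A self-adjoint element is a difference of two positive ones. *)
Lemma positive_map_real (Phi : {linear B -> bop H}) u h : positive_map Phi -> star u = u ->
  hdot (Phi u h) h \is Num.real.
Proof.
move=> Phi_pos su; have pos v : psd v -> hdot (Phi v h) h \is Num.real.
  by move=> /psd_cstar_pos /Phi_pos pv; apply: ger0_real; apply: pv.
have -> : u = (nrm u *r 1 + u) - nrm u *r 1 by linear_identity; ring.
rewrite linearB /= hdotDl hdotNl; apply: realB; apply: pos.
  exact: psd_scalarD.
exact/psd_scalar/nrm_ge0.
Qed.

Lemma positive_map_star (Phi : {linear B -> bop H}) w : positive_map Phi ->
  Phi (star w) = adjoint (Phi w).
Proof.
move=> Phi_pos; apply: bop_ext => h.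
have [p [q [sp sq ->]]] : exists p q, [/\ star p = p, star q = q & w = p + 'i *: q].
  by exists (re_part w), (im_part w); split; [exact: re_part_sa|exact: im_part_sa|exact: cartesian].
have rp := positive_map_real h Phi_pos sp; have rq := positive_map_real h Phi_pos sq.
rewrite [RHS]hdotC -adjointE starD starZ conjCi sp sq scaleNr linearB linearD linearZ /=.
rewrite !hdotDl hdotNl hdotZl rmorphD rmorphM /= conjCi mulNr.
by rewrite !conj_Creal.
Qed.

Lemma completely_positive_positive (Psi : {linear B -> bop H}) :
  completely_positive Psi -> positive_map Psi.
Proof.
move=> Psi_cp b [c ->] h; have := Psi_cp 1 (const_mx (star c * c)) _ (fun=> h).
rewrite !big_ord_recl !big_ord0 !mxE !addr0; apply.
exists (const_mx c); apply/matrixP => i j.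
by rewrite !mxE big_ord_recl big_ord0 !mxE addr0.
Qed.

(** The Schwarz inequality for unital 2-positive maps, from the positivity of the
    matrix X^* X where X has first row (b, 1) and second row 0. *)
Lemma completely_positive_schwarz (Psi : {linear B -> bop H}) :
  completely_positive Psi -> Psi 1 = 1 ->
  forall b, bop_le (adjoint (Psi b) * Psi b) (Psi (star b * b)).
Proof.
move=> Psi_cp Psi1 b h; have Psi_pos := completely_positive_positive Psi_cp.
pose X : 'M[B]_2 := \matrix_(i, j) if i == ord0 then if j == ord0 then b else 1 else 0.
(* Evaluating Psi (X^* X) at (h, - Psi b h) completes the square. *)
pose k (i : 'I_2) : H := if i == ord0 then h else - Psi b h.
have := Psi_cp 2 (mx_star X *m X) (ex_intro _ X erefl) k.
rewrite !big_ord_recl !big_ord0 !mxE !big_ord_recl !big_ord0 !mxE /= !star0 !mul0r !addr0.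
rewrite star1 mulr1 !mul1r (positive_map_star _ Psi_pos) Psi1.
by rewrite /k /= linearN /= !hdotDl !hdotNl !hdotNr subrr addr0.
Qed.

End PositiveMaps.

(** * The directional derivative of a superadditive functional *)

(** Columns and rows lead to the same construction, so it is carried out for an
    abstract pair: sq a stands for a^* a or a a^*, and vl a for |rho(a) h|^2 or
    |rho(a)^* h|^2. *)
Section Minorant.
Variables (R : realType) (B : unitalCstar R) (S : pred B) (A : subAlgType S).
Implicit Types (a c : A) (u v w : B) (r s t m k d e : R).

Variables (sq : A -> B) (vl : A -> R).
Hypothesis sq_one : sq 1 = 1.
Hypothesis sq_psd : forall a, psd (sq a).
Hypothesis vl_ge0 : forall a, 0 <= vl a.
Hypothesis vl_dominated : forall a1 a2 c m1 m2 k, invertible c ->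
  0 <= m1 -> 0 <= m2 -> 0 <= k ->
  psd (k *r sq c - (m1 *r sq a1 + m2 *r sq a2)) ->
  m1 * vl a1 + m2 * vl a2 <= k * vl c.
Hypothesis sq_dense : forall w d e, 0 < d -> 0 < e < 1 -> psd (w - d *r 1) ->
  exists c, [/\ invertible c, psd (w - sq c) & psd (sq c - (1 - e) *r w)].

(** Up to the substitution t = 1/s, these are the difference quotients
    ((m/s) vl a - vl 1) / t over the elements (m/s) sq a <= 1 + t u. Clearing
    denominators makes sums of constraints correspond to sums of parameters. The
    condition |u| < s keeps s + u bounded below, so that sq_dense applies to it. *)
Definition minorants u : set R := [set r | exists s m a,
  [/\ nrm u < s, 0 <= m, psd (s *r 1 + u - m *r sq a) & r = m * vl a - s * vl 1]].

(** The derivative at 1 in direction u: for a concave function the difference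
    quotients increase to it as t decreases to 0, so it is their supremum. *)
Definition tangent u : R := sup (minorants u).

Lemma invertible1 : invertible (1 : A).
Proof. by exists 1; rewrite mulr1. Qed.

Lemma minorants_ub u : star u = u -> ubound (minorants u) (nrm u * vl 1).
Proof.
move=> su _ [s [m [a [us m0 le ->]]]]; rewrite lerBlDr -mulrDl.
have s0 : 0 <= s := le_trans (nrm_ge0 _) (ltW us).
have := vl_dominated (a1 := a) (a2 := a) invertible1 m0 (lexx 0) (addr_ge0 (nrm_ge0 u) s0).
rewrite mul0r addr0; apply.
have -> : (nrm u + s) *r sq 1 - (m *r sq a + 0 *r sq a) =
    (s *r 1 + u - m *r sq a) + (nrm u *r 1 - u).
  by rewrite sq_one; linear_identity; ring.
by apply: psdD => //; apply: psd_scalarB.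
Qed.

Lemma minorants_neq0 u : star u = u -> minorants u !=set0.
Proof.
move=> su; exists (0 * vl 1 - (nrm u + 1) * vl 1), (nrm u + 1), 0, 1.
split=> //; first by rewrite ltrDl.
rewrite rsc0 subr0; apply: psd_scalarD => //; lra.
Qed.

Lemma tangent_le u : star u = u -> tangent u <= nrm u * vl 1.
Proof. by move=> su; apply: ge_sup; [exact: minorants_neq0|exact: minorants_ub]. Qed.

Lemma tangent_ge u s m a : star u = u -> nrm u < s -> 0 <= m ->
  psd (s *r 1 + u - m *r sq a) -> m * vl a - s * vl 1 <= tangent u.
Proof.
move=> su us m0 le; apply: sup_ubound; last by exists s, m, a.
by exists (nrm u * vl 1); exact: minorants_ub.
Qed.

(** The element m1 sq a1 + m2 sq a2 need not be of the form m sq a. It is replaced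
    by sq c with (1 - e)(s + u) <= sq c <= s + u, which dominates it up to the
    factor 1 - e. *)
Lemma tangent_ge2 u s m1 m2 a1 a2 : star u = u -> nrm u < s ->
  0 <= m1 -> 0 <= m2 -> psd (s *r 1 + u - (m1 *r sq a1 + m2 *r sq a2)) ->
  m1 * vl a1 + m2 * vl a2 - s * vl 1 <= tangent u.
Proof.
move=> su us m10 m20 le; set V := m1 * vl a1 + m2 * vl a2.
have V0 : 0 <= V by rewrite addr_ge0 ?mulr_ge0.
have main e : 0 < e < 1 -> (1 - e) * V <= s * vl 1 + tangent u.
  move=> e01; have d0 : 0 < s - nrm u by rewrite subr_gt0.
  have pw : psd (s *r 1 + u - (s - nrm u) *r 1).
    have -> : s *r 1 + u - (s - nrm u) *r 1 = nrm u *r 1 + u by linear_identity; ring.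
    exact: psd_scalarD.
  have [c [ci cw wc]] := sq_dense d0 e01 pw.
  have e1 : 0 <= 1 - e by lra.
  have := vl_dominated (a1 := a1) (a2 := a2) ci (mulr_ge0 e1 m10) (mulr_ge0 e1 m20) ler01.
  rewrite -!mulrA -mulrDr mul1r -/V => VC; apply: le_trans (VC _) _.
    have -> : 1 *r sq c - (((1 - e) * m1) *r sq a1 + ((1 - e) * m2) *r sq a2) =
       (sq c - (1 - e) *r (s *r 1 + u)) +
       (1 - e) *r (s *r 1 + u - (m1 *r sq a1 + m2 *r sq a2)).
      by linear_identity; ring.
    by apply: psdD => //; exact: psdZ.
  rewrite -lerBlDl -[vl c]mul1r; apply: tangent_ge => //; by rewrite rsc1.
rewrite lerBlDl -subr_le0; apply: (@le0_eps _ V) => e e0.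
have [e1|e1] := ltP e 1; first by have := main e; rewrite e0 e1 => /(_ isT); lra.
have : (1 - 2^-1) * V <= s * vl 1 + tangent u by apply: main; apply/andP; split; lra.
nra.
Qed.

Lemma tangent_superadditive u v : star u = u -> star v = v ->
  tangent u + tangent v <= tangent (u + v).
Proof.
move=> su sv; rewrite -lerBrDr; apply: ge_sup; first exact: minorants_neq0.
move=> _ [s [m [a [us m0 le ->]]]]; rewrite lerBrDl -lerBrDr.
apply: ge_sup; first exact: minorants_neq0.
move=> _ [s' [m' [a' [us' m0' le' ->]]]].
have suv : star (u + v) = u + v by rewrite starD su sv.
rewrite lerBrDr.
have -> : m' * vl a' - s' * vl 1 + (m * vl a - s * vl 1) =
  m * vl a + m' * vl a' - (s + s') * vl 1 by ring.
apply: tangent_ge2 => //; first by apply: le_lt_trans (nrmD _ _) _; rewrite ltrD.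
have -> : (s + s') *r 1 + (u + v) - (m *r sq a + m' *r sq a') =
  (s *r 1 + u - m *r sq a) + (s' *r 1 + v - m' *r sq a') by linear_identity; ring.
exact: psdD.
Qed.

Lemma tangent_scale_le t u : star u = u -> 0 < t -> t * tangent u <= tangent (t *r u).
Proof.
move=> su t0; rewrite -ler_pdivlMl //; apply: ge_sup; first exact: minorants_neq0.
move=> _ [s [m [a [us m0 le ->]]]]; rewrite ler_pdivlMl // mulrBr !mulrA.
apply: tangent_ge; rewrite ?star_rsc ?su //.
- by rewrite nrmZ gtr0_norm // ltr_pM2l.
- by rewrite mulr_ge0 // ltW.
have -> : (t * s) *r 1 + t *r u - (t * m) *r sq a = t *r (s *r 1 + u - m *r sq a).
  by linear_identity; ring.
exact: psdZ (ltW t0) le.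
Qed.

Lemma tangent_scale t u : star u = u -> 0 < t -> tangent (t *r u) = t * tangent u.
Proof.
move=> su t0; apply: le_anti; rewrite tangent_scale_le // andbT.
have stu : star (t *r u) = t *r u by rewrite star_rsc su.
rewrite -ler_pdivrMl //; apply: le_trans (tangent_scale_le stu _) _.
  by rewrite invr_gt0.
by rewrite rscA mulVf ?gt_eqF // rsc1.
Qed.

(** The constraint (|sq a| + 1) sq 1 + sq a <= (|sq a| + 1) + sq a is an equality,
    so sq a itself contributes vl a. *)
Lemma tangent_sq a : vl a <= tangent (sq a).
Proof.
have [su _] := sq_psd a.
have n0 : 0 <= nrm (sq a) + 1 by rewrite addr_ge0 ?nrm_ge0.
have {1}-> : vl a = (nrm (sq a) + 1) * vl 1 + 1 * vl a - (nrm (sq a) + 1) * vl 1 by ring.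
apply: tangent_ge2 => //; first by rewrite ltrDl.
rewrite sq_one rsc1 subrr -(rsc0 (1 : B)); exact: psd_scalar.
Qed.

Lemma tangent_ge0 u : psd u -> 0 <= tangent u.
Proof.
move=> pu; have [su _] := pu.
have n0 : 0 <= nrm u + 1 by rewrite addr_ge0 ?nrm_ge0.
rewrite -(subrr ((nrm u + 1) * vl 1)); apply: tangent_ge => //; first by rewrite ltrDl.
by rewrite sq_one addrC addKr.
Qed.

End Minorant.

(** * The two functionals attached to a contractive representation *)

Section Representation.
Variables (R : realType) (B : unitalCstar R) (S : pred B) (A : subAlgType S).
Variables (H : hilbertType R) (rho : {lrmorphism A -> bop H}).
Implicit Types (a b c : A) (x h : H) (w : B) (m k d e r : R).

Definition colsq a : B := star (val a) * val a.
Definition rowsq a : B := val a * star (val a).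
Definition colval h a : R := rnorm (rho a h) ^+ 2.
Definition rowval h a : R := rnorm (adjoint (rho a) h) ^+ 2.

Definition col_tangent h (u : B) : R := tangent colsq (colval h) u.
Definition row_tangent h (u : B) : R := tangent rowsq (rowval h) u.

Lemma col_contractive a b h : C_contractive 2 rho ->
  colval h a + colval h b <= nrm (colsq a + colsq b) * rnorm h ^+ 2.
Proof.
move=> /(_ (fun i : 'I_2 => if i == ord0 then a else b)).
move=> /col_opnorm_bound/(_ h).
rewrite /col_norm sqr_sqrtr; last exact: nrm_ge0.
by rewrite !big_ord_recl !big_ord0 /= !addr0.
Qed.

Lemma row_contractive a b h : R_contractive 2 rho ->
  rowval h a + rowval h b <= nrm (rowsq a + rowsq b) * rnorm h ^+ 2.
Proof.
move=> /(_ (fun i : 'I_2 => if i == ord0 then a else b)).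
move=> /row_opnorm_adjoint_bound/(_ h).
rewrite /row_norm sqr_sqrtr; last exact: nrm_ge0.
by rewrite !big_ord_recl !big_ord0 /= !addr0.
Qed.

Lemma rho_rsc r a x : rho (r *r a) x = r *r rho a x.
Proof. by rewrite linearZ. Qed.

Lemma colsqZ r a : colsq (r *r a) = (r ^+ 2) *r colsq a.
Proof. by rewrite /colsq linearZ /= star_rsc rscMl rscMr rscA. Qed.

Lemma rowsqZ r a : rowsq (r *r a) = (r ^+ 2) *r rowsq a.
Proof. by rewrite /rowsq linearZ /= star_rsc rscMl rscMr rscA. Qed.

Lemma colvalZ r a h : colval h (r *r a) = r ^+ 2 * colval h a.
Proof. by rewrite /colval rho_rsc rnormZ exprMn real_normK ?num_real. Qed.

Lemma rowvalZ r a h : rowval h (r *r a) = r ^+ 2 * rowval h a.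
Proof. by rewrite /rowval linearZ /= adjoint_rsc rnormZ exprMn real_normK ?num_real. Qed.

Lemma colsqM a b : colsq (a * b) = star (val b) * colsq a * val b.
Proof. by rewrite /colsq rmorphM starM !mulrA. Qed.

Lemma rowsqM a b : rowsq (a * b) = val a * rowsq b * star (val a).
Proof. by rewrite /rowsq rmorphM starM !mulrA. Qed.

Lemma colsq_psd a : psd (colsq a). Proof. exact: psd_starM. Qed.

Lemma rowsq_psd a : psd (rowsq a).
Proof. by rewrite /rowsq -{1}(starK (val a)); exact: psd_starM. Qed.

Lemma colsq1 : colsq 1 = 1. Proof. by rewrite /colsq rmorph1 star1 mulr1. Qed.
Lemma rowsq1 : rowsq 1 = 1. Proof. by rewrite /rowsq rmorph1 star1 mulr1. Qed.

Lemma colval1 h : colval h 1 = rnorm h ^+ 2.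
Proof. by rewrite /colval rmorph1. Qed.
Lemma rowval1 h : rowval h 1 = rnorm h ^+ 2.
Proof. by rewrite /rowval rmorph1 adjoint1. Qed.

Lemma colval_ge0 h a : 0 <= colval h a. Proof. exact: sqr_ge0. Qed.
Lemma rowval_ge0 h a : 0 <= rowval h a. Proof. exact: sqr_ge0. Qed.

Lemma rhoMV a b x : a * b = 1 -> rho a (rho b x) = x.
Proof.
move=> ab; have : rho (a * b) x = x by rewrite ab rmorph1.
by rewrite rmorphM.
Qed.

(** C_2-contractivity for the elements sqrt(mi) ai c^-1, at the vector rho(c) h. *)
Lemma colval_dominated h (hC : C_contractive 2 rho) a1 a2 c m1 m2 k : invertible c ->
  0 <= m1 -> 0 <= m2 -> 0 <= k ->
  psd (k *r colsq c - (m1 *r colsq a1 + m2 *r colsq a2)) ->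
  m1 * colval h a1 + m2 * colval h a2 <= k * colval h c.
Proof.
move=> [c' [cc' c'c]] m10 m20 k0 le.
have vcc' : val c * val c' = 1 by rewrite -rmorphM cc' rmorph1.
pose b m a : A := Num.sqrt m *r (a * c').
have bsq m a : 0 <= m -> colsq (b m a) = m *r (star (val c') * colsq a * val c').
  by move=> m0; rewrite colsqZ sqr_sqrtr // colsqM.
have bval m a : 0 <= m -> colval (rho c h) (b m a) = m * colval h a.
  move=> m0; rewrite colvalZ sqr_sqrtr //; congr (_ * _).
  by rewrite /colval rmorphM /= (rhoMV _ c'c).
have := col_contractive (b m1 a1) (b m2 a2) (rho c h) hC.
rewrite !bval // => /le_trans; apply; apply: ler_wpM2r; first exact: sqr_ge0.
apply: psd_norm_le => //; first by apply: psdD; exact: colsq_psd.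
have := psd_conj (val c') le; rewrite !bsq // mulrBr mulrBl mulrDr mulrDl !rscMr !rscMl.
suff -> : star (val c') * colsq c * val c' = 1 by [].
by rewrite /colsq -!mulrA vcc' mulr1 -starM vcc' star1.
Qed.

(** R_2-contractivity for the elements sqrt(mi) c^-1 ai, at the vector
    rho(c)^* h. *)
Lemma rowval_dominated h (hR : R_contractive 2 rho) a1 a2 c m1 m2 k : invertible c ->
  0 <= m1 -> 0 <= m2 -> 0 <= k ->
  psd (k *r rowsq c - (m1 *r rowsq a1 + m2 *r rowsq a2)) ->
  m1 * rowval h a1 + m2 * rowval h a2 <= k * rowval h c.
Proof.
move=> [c' [cc' c'c]] m10 m20 k0 le.
have vc'c : val c' * val c = 1 by rewrite -rmorphM c'c rmorph1.
pose b m a : A := Num.sqrt m *r (c' * a).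
have bsq m a : 0 <= m -> rowsq (b m a) = m *r (val c' * rowsq a * star (val c')).
  by move=> m0; rewrite rowsqZ sqr_sqrtr // rowsqM.
have bval m a : 0 <= m -> rowval (adjoint (rho c) h) (b m a) = m * rowval h a.
  move=> m0; rewrite rowvalZ sqr_sqrtr //; congr (_ * _).
  by rewrite /rowval -[in RHS](mul1r a) -cc' -mulrA [in RHS]rmorphM adjointM.
have := row_contractive (b m1 a1) (b m2 a2) (adjoint (rho c) h) hR.
rewrite !bval // => /le_trans; apply; apply: ler_wpM2r; first exact: sqr_ge0.
apply: psd_norm_le => //; first by apply: psdD; exact: rowsq_psd.
have := psd_conj (star (val c')) le; rewrite starK !bsq // mulrBr mulrBl mulrDr mulrDl !rscMr !rscMl.
suff -> : val c' * rowsq c * star (val c') = 1 by [].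
by rewrite /rowsq !mulrA vc'c mul1r -starM vc'c star1.
Qed.

Hypothesis hA : logmodular A.

Lemma logmodular_approx w e : psd w -> invertible w -> 0 < e ->
  exists2 c : A, invertible c & nrm (colsq c - w) <= e.
Proof.
move=> pw iw e0; have := hA (conj (proj1 (psd_cstar_pos w) pw) iw).
have nb : nbhs w (ball w e%:C%C) by apply: nbhsx_ballx; rewrite ltcR.
move=> /(_ _ nb)[_ [[c ic <-]]]; rewrite -ball_normE /= -nrmE ltcR => /ltW we.
by exists c => //; rewrite nrmBC.
Qed.

(** Approximating (1 - e/2) w within e d / 2 in norm gives two-sided order bounds,
    because w >= d. *)
Lemma colsq_dense w d e : 0 < d -> 0 < e < 1 -> psd (w - d *r 1) ->
  exists c, [/\ invertible c, psd (w - colsq c) & psd (colsq c - (1 - e) *r w)].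
Proof.
move=> d0 /andP[e0 e1] pwd.
have [sw' _] := pwd.
have pw : psd w.
  have -> : w = (w - d *r 1) + d *r 1 by rewrite subrK.
  by apply: psdD => //; apply: psd_scalar; exact: ltW.
have [sw _] := pw.
pose b : B := (1 - e / 2) *r w.
have [|||c ic cb] := @logmodular_approx b (e * d / 2).
- by apply: psdZ => //; lra.
- apply: (@psd_invertible _ _ _ ((1 - e / 2) * d)); first by rewrite mulr_gt0 //; lra.
  have -> : b - ((1 - e / 2) * d) *r 1 = (1 - e / 2) *r (w - d *r 1).
    by rewrite /b; linear_identity; field.
  by apply: psdZ => //; lra.
- by rewrite divr_gt0 ?mulr_gt0.
have sc : star (colsq c - b) = colsq c - b.
  by rewrite starB star_rsc sw (proj1 (colsq_psd c)).
have pe : psd ((e / 2) *r (w - d *r 1)) by apply: psdZ => //; lra.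
exists c; split=> //.
- have -> : w - colsq c = ((e * d / 2) *r 1 - (colsq c - b)) + (e / 2) *r (w - d *r 1).
    by rewrite /b; linear_identity; field.
  by apply: psdD => //; exact: psd_scalarB.
- have -> : colsq c - (1 - e) *r w = ((e * d / 2) *r 1 + (colsq c - b)) + (e / 2) *r (w - d *r 1).
    by rewrite /b; linear_identity; field.
  by apply: psdD => //; exact: psd_scalarD.
Qed.

(** Logmodularity concerns elements c^* c only. It is applied to the inverse of
    w; inverting reverses the inequalities, and the inverse c' of c has
    c' c'^* = (c^* c)^-1. *)
Lemma rowsq_dense w d e : 0 < d -> 0 < e < 1 -> psd (w - d *r 1) ->
  exists c, [/\ invertible c, psd (w - rowsq c) & psd (rowsq c - (1 - e) *r w)].
Proof.
move=> d0 e01 pwd; have /andP[e0 e1] := e01.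
have pw : psd w.
  have -> : w = (w - d *r 1) + d *r 1 by rewrite subrK.
  by apply: psdD => //; apply: psd_scalar; exact: ltW.
have [sw _] := pw.
have [v [wv vw]] := psd_invertible d0 pwd.
have pv := psd_inverse pw wv vw.
pose M := nrm w + 1; have M0 : 0 < M by rewrite ltr_wpDl ?nrm_ge0.
have pvM : psd (v - M^-1 *r 1).
  have -> : v - M^-1 *r 1 = M^-1 *r (v * (M *r 1 - w)).
    by rewrite mulrBr vw rscMr mulr1; linear_identity; field; rewrite gt_eqF.
  apply: psdZ; first by rewrite invr_ge0 ltW.
  apply: psd_mul_comm => //; first by apply: psd_scalarB => //; rewrite /M; lra.
  by rewrite mulrBr mulrBl rscMl rscMr mulr1 mul1r wv vw.
have [|c [[c' [cc' c'c]] vc cv]] := colsq_dense _ e01 pvM; first by rewrite invr_gt0.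
have vcc' : val c * val c' = 1 by rewrite -rmorphM cc' rmorph1.
have vc'c : val c' * val c = 1 by rewrite -rmorphM c'c rmorph1.
have ge := inverse_antitone_ge pw wv vw vcc' vc'c vc.
have m0 : 0 <= (1 - e)^-1 by rewrite invr_ge0; lra.
have ne : 1 - e != 0 by apply/eqP; lra.
have le : psd ((1 - e)^-1 *r w - val c' * star (val c')).
  apply: (inverse_antitone_le m0 pw wv vw vcc' vc'c).
  have -> : (1 - e)^-1 *r (star (val c) * val c) - v = (1 - e)^-1 *r (colsq c - (1 - e) *r v).
    by rewrite /colsq; linear_identity; field.
  exact: psdZ.
have s0 : 0 < Num.sqrt (1 - e) by rewrite sqrtr_gt0; lra.
exists (Num.sqrt (1 - e) *r c'); rewrite rowsqZ sqr_sqrtr; last lra.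
split.
- exists ((Num.sqrt (1 - e))^-1 *r c).
  rewrite -!scalerAl -!scalerAr !scalerA -!rmorphM mulfV ?mulVf ?gt_eqF //.
  by rewrite cc' c'c scale1r.
- have -> : w - (1 - e) *r rowsq c' = (1 - e) *r ((1 - e)^-1 *r w - val c' * star (val c')).
    by rewrite /rowsq; linear_identity; field.
  by apply: psdZ => //; lra.
- by rewrite -scalerBr; apply: psdZ => //; lra.
Qed.

End Representation.

(** * The extension and its uniqueness *)

Section Extension.
Variables (R : realType) (B : unitalCstar R) (S : pred B) (A : subAlgType S).
Variables (H : hilbertType R) (rho : {lrmorphism A -> bop H}).
Hypothesis hA : logmodular A.
Hypothesis rhoR : R_contractive 2 rho.
Hypothesis rhoC : C_contractive 2 rho.
Implicit Types (a b c : A) (x h : H) (u v w : B) (m k d e r s t : R).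

Local Notation D := (col_tangent rho).
Local Notation E := (row_tangent rho).

Let cdom h := fun a1 a2 c m1 m2 k =>
  @colval_dominated _ _ _ _ _ rho h rhoC a1 a2 c m1 m2 k.
Let rdom h := fun a1 a2 c m1 m2 k =>
  @rowval_dominated _ _ _ _ _ rho h rhoR a1 a2 c m1 m2 k.

(** Cauchy-Schwarz for <rho(a) h, rho(c)^* h> = |h|^2. *)
Lemma hdot_col_row a c h : c * a = 1 ->
  (rnorm h ^+ 2) ^+ 2 <= colval rho h a * rowval rho h c.
Proof.
move=> ca; rewrite /colval /rowval -exprMn ler_pXn2r ?nnegrE ?mulr_ge0 ?sqr_ge0 ?rnorm_ge0 //.
rewrite -lecR -hdotE rmorphM /= !rnormE; apply: le_trans (hdot_CS _ _).
by rewrite -adjointE (rhoMV _ _ ca) hdotE ger0_norm // ler0c sqr_ge0.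
Qed.

(** For s large choose an invertible a with a^* a close to s + u, with inverse c. Then
    k c c^* <= s - u for k = (1 - eta)(s^2 - |u|^2), because
    (s^2 - |u|^2)(s + u)^-1 <= s - u. So a contributes |rho(a) h|^2 - s |h|^2, the
    form of rho(a)^* rho(a) - s, to D_h(u), and c contributes
    k |rho(c)^* h|^2 - s |h|^2 to E_h(-u). By hdot_col_row and amgm_gap these add up
    to at least - e |h|^2, once (s - e/2)^2 <= k. The operator does not depend
    on h. *)
Lemma tangent_approx u e : star u = u -> 0 < e -> exists T : bop H, forall h,
  exists q : R, [/\ hdot (T h) h = q%:C%C, q <= D h u & - q - e * rnorm h ^+ 2 <= E h (- u)].
Proof.
move=> su e0; pose M := nrm u; have M0 : 0 <= M := nrm_ge0 u.
(* Large enough for (s - e/2)^2 <= k below: with eta s^2 = 1 this asks for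
   M^2 + 1 + e^2/4 <= s e. *)
pose s := (M ^+ 2 + 2 + e ^+ 2) / e + M + 2 + e.
have q0 : 0 <= (M ^+ 2 + 2 + e ^+ 2) / e.
  by rewrite divr_ge0 ?(ltW e0) // !addr_ge0 ?sqr_ge0.
have Ms : M < s by rewrite /s; lra.
have s1 : 1 < s by rewrite /s; lra.
have es : e < s by rewrite /s; lra.
have se : M ^+ 2 + 2 + e ^+ 2 <= s * e.
  by rewrite -ler_pdivrMr // /s; lra.
pose eta := (s ^+ 2)^-1.
have eta01 : 0 < eta < 1.
  by rewrite invr_gt0 exprn_gt0 ?invf_lt1 ?exprn_gt0 ?exprn_egt1 //; lra.
have etas : eta * s ^+ 2 = 1 by rewrite mulVf // expf_neq0 // gt_eqF //; lra.
have sM0 : 0 < s - M by rewrite subr_gt0.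
pose w : B := s *r 1 + u.
have pwd : psd (w - (s - M) *r 1).
  have -> : w - (s - M) *r 1 = M *r 1 + u by rewrite /w; linear_identity; ring.
  exact: psd_scalarD.
have pw : psd w by apply: psd_scalarD => //; exact: ltW.
have [v [wv vw]] := psd_invertible sM0 pwd.
have pv := psd_inverse pw wv vw.
have [a [[c [ac ca]] wa aw]] := colsq_dense hA sM0 eta01 pwd.
have vac : val a * val c = 1 by rewrite -rmorphM ac rmorph1.
have vca : val c * val a = 1 by rewrite -rmorphM ca rmorph1.
have eta1 : 0 < 1 - eta by case/andP: eta01; lra.
have m0 : 0 <= (1 - eta)^-1 by rewrite invr_ge0 ltW.
have le : psd ((1 - eta)^-1 *r v - rowsq c).
  apply: (inverse_antitone_le m0 pv vw wv vac vca).
  have -> : (1 - eta)^-1 *r (star (val a) * val a) - w = (1 - eta)^-1 *r (colsq a - (1 - eta) *r w).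
    by rewrite /colsq; linear_identity; field; rewrite gt_eqF.
  exact: psdZ.
pose k := (1 - eta) * (s ^+ 2 - M ^+ 2).
have sM2 : 0 <= s ^+ 2 - M ^+ 2 by rewrite subr_ge0 ler_pXn2r ?nnegrE //; lra.
have k0 : 0 <= k by rewrite mulr_ge0 // ltW.
have uv : u * v = v * u.
  have uw : w * u = u * w by rewrite mulrDl mulrDr rscMl rscMr mulr1 mul1r.
  by rewrite -[LHS]mul1r -vw -mulrA (mulrA w) uw -!mulrA wv mulr1.
have lek : psd (s *r 1 - u - k *r rowsq c).
  have -> : s *r 1 - u - k *r rowsq c =
     v * (M ^+ 2 *r 1 - u * u) + k *r ((1 - eta)^-1 *r v - rowsq c).
    have -> : s *r 1 - u = v * (s ^+ 2 *r 1 - u * u).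
      have -> : s ^+ 2 *r 1 - u * u = w * (s *r 1 - u).
        rewrite /w mulrBr !mulrDl !rscMl !rscMr !mulr1 !mul1r.
        by linear_identity; ring.
      by rewrite mulrA vw mul1r.
    rewrite !mulrBr !rscMr mulr1 /k.
    by linear_identity; field; rewrite gt_eqF.
  apply: psdD; last exact: psdZ.
  apply: psd_mul_comm => //; first by apply: psd_scalarB; rewrite ?starM ?su // nrm_sq.
  by rewrite mulrBr mulrBl rscMr rscMl mulr1 mul1r mulrA -uv -mulrA -uv mulrA.
exists ((adjoint (rho a) * rho a : bop H) - s *r (1 : bop H)) => h.
exists (colval rho h a - s * rnorm h ^+ 2); split.
- rewrite /= hdotDl hdotNl hdotZl hdotC -adjointE /colval !hdotE.
  rewrite rmorphB /= (rmorphM (real_complex R) s) /= conj_Creal //.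
  by rewrite realE ler0c sqr_ge0.
- rewrite -(colval1 rho h) -[colval _ _ a]mul1r; apply: tangent_ge => //.
  + exact: colsq1.
  + exact: cdom.
  + by rewrite rsc1.
- have : k * rowval rho h c - s * rowval rho h 1 <= E h (- u).
    apply: tangent_ge => //.
    + exact: rowsq1.
    + exact: rdom.
    + by rewrite starN su.
    + by rewrite nrmN.
  apply: le_trans; rewrite rowval1.
  have se2 : (s - e / 2) ^+ 2 <= k.
    rewrite /k mulrBl mul1r mulrBr etas.
    by have := mulr_ge0 (ltW (proj1 (andP eta01))) (sqr_ge0 M); nra.
  have e20 : 0 <= e / 2 by lra.
  have e2s : e / 2 <= s by lra.
  have := amgm_gap (colval_ge0 rho h a) (rowval_ge0 rho h c) (sqr_ge0 (rnorm h))
    (hdot_col_row h ca) e20 e2s se2.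
  lra.
Qed.

Lemma col_superadditive h u v : star u = u -> star v = v -> D h u + D h v <= D h (u + v).
Proof.
move=> su sv; apply: tangent_superadditive => //.
- exact: colsq1.
- exact: colval_ge0.
- exact: cdom.
- exact: colsq_dense.
Qed.

Lemma row_superadditive h u v : star u = u -> star v = v -> E h u + E h v <= E h (u + v).
Proof.
move=> su sv; apply: tangent_superadditive => //.
- exact: rowsq1.
- exact: rowval_ge0.
- exact: rdom.
- exact: rowsq_dense.
Qed.

Lemma col_tangent_le h u : star u = u -> D h u <= nrm u * rnorm h ^+ 2.
Proof.
move=> su; rewrite -(colval1 rho h); apply: tangent_le => //; last exact: cdom.
exact: colsq1.
Qed.

Lemma row_tangent_le h u : star u = u -> E h u <= nrm u * rnorm h ^+ 2.
Proof.
move=> su; rewrite -(rowval1 rho h); apply: tangent_le => //; last exact: rdom.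
exact: rowsq1.
Qed.

(** D(u) + D(-u) <= 0 <= D(u) + E(-u) gives D(-u) <= E(-u), and exchanging the
    roles of D and E, and of u and -u, gives the reverse inequality. *)
Lemma col_tangent_eq_row h u : star u = u -> E h u = D h u /\ D h (- u) = - D h u.
Proof.
move=> su; have sNu : star (- u) = - u by rewrite starN su.
have DE v : star v = v -> 0 <= D h v + E h (- v).
  move=> sv; rewrite -oppr_le0; apply: (@le0_eps _ (rnorm h ^+ 2)) => e e0.
  by have [T /(_ h)[q [_ qD qE]]] := tangent_approx sv e0; lra.
have D0 := col_superadditive h su sNu; have E0 := row_superadditive h su sNu.
have := col_tangent_le h (star0 B); have := row_tangent_le h (star0 B).
rewrite subrr in D0 E0; rewrite nrm0 mul0r.
have := DE _ su; have := DE _ sNu; rewrite opprK.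
by split; lra.
Qed.

Lemma col_tangentD h u v : star u = u -> star v = v -> D h (u + v) = D h u + D h v.
Proof.
move=> su sv; have suv : star (u + v) = u + v by rewrite starD su sv.
have [_ Nu] := col_tangent_eq_row h su; have [_ Nv] := col_tangent_eq_row h sv.
have [_ Nuv] := col_tangent_eq_row h suv.
have := col_superadditive h su sv; have := @col_superadditive h (- u) (- v).
rewrite !starN su sv -opprD Nu Nv Nuv.
by move=> /(_ erefl erefl); lra.
Qed.

Lemma col_tangent0 h : D h 0 = 0.
Proof.
have := @col_tangentD h 0 0 (star0 B) (star0 B); rewrite addr0; lra.
Qed.

Lemma col_tangentZ h t u : star u = u -> D h (t *r u) = t * D h u.
Proof.
move=> su; have pos s : 0 < s -> D h (s *r u) = s * D h u.
  move=> s0; apply: tangent_scale => //; last exact: cdom.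
  exact: colsq1.
case: (ltgtP t 0) => [t0|t0|->]; [|exact: pos|by rewrite rsc0 col_tangent0 mul0r].
have := pos (- t); rewrite oppr_gt0 rscN => /(_ t0).
have [_ ->] : E h (t *r u) = D h (t *r u) /\ D h (- (t *r u)) = - D h (t *r u).
  by apply: col_tangent_eq_row; rewrite star_rsc su.
by rewrite mulNr => /oppr_inj.
Qed.

Definition form h w : R[i] := (D h (re_part w))%:C%C + 'i * (D h (im_part w))%:C%C.

Lemma form_linear h (c : R[i]) v w : form h (c *: v + w) = c * form h v + form h w.
Proof.
have i2 : 'i * 'i = -1 :> R[i] by rewrite -expr2 sqrCi.
rewrite {1 2}(complex_parts c); set x := complex.Re c; set y := complex.Im c.
have ez : (x%:C%C + 'i * y%:C%C) *: v = x *r v + y *r ('i *: v).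
  by rewrite scalerDl -scalerA [_ *: (_ *: v)]scalerA mulrC -scalerA.
have srsc r (p : B) : star p = p -> star (r *r p) = r *r p by move=> sp; rewrite star_rsc sp.
have sD (p q : B) : star p = p -> star q = q -> star (p + q) = p + q.
  by move=> sp sq; rewrite starD sp sq.
have sN (p : B) : star p = p -> star (- p) = - p by move=> sp; rewrite starN sp.
rewrite /form ez !(im_partD, re_partD, im_part_rsc, re_part_rsc, re_part_i, im_part_i).
move: (re_part_sa v) (re_part_sa w) (im_part_sa v) (im_part_sa w).
move: (re_part v) (re_part w) (im_part v) (im_part w) => pv pw qv qw spv spw sqv sqw.
have [_ Nim] := col_tangent_eq_row h sqv.
rewrite !col_tangentD ?col_tangentZ ?Nim; try by do ?[apply: sD | apply: srsc | apply: sN].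
rewrite !(rmorphD (real_complex R), rmorphM (real_complex R), rmorphN (real_complex R)) /=.
by ring: i2.
Qed.

Lemma tangent_approx2 u e : star u = u -> 0 < e -> exists T : bop H, forall h,
  `|(D h u)%:C%C - hdot (T h) h| <= (e * rnorm h ^+ 2)%:C%C.
Proof.
move=> su e0; have [T Tq] := tangent_approx su e0; exists T => h.
have [q [-> qD qE]] := Tq h; have sNu : star (- u) = - u by rewrite starN su.
have [EN _] := col_tangent_eq_row h sNu; have [_ DN] := col_tangent_eq_row h su.
have D0 : 0 <= D h u - q by rewrite subr_ge0.
rewrite -rmorphB ger0_norm ?ler0c // lecR.
by move: qE; rewrite EN DN; lra.
Qed.

Lemma form_operator w : exists T : bop H, forall h, form h w = hdot (T h) h.
Proof.
apply: quad_form_limit => e e0.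
have e20 : 0 < e / 2 by lra.
have [T1 T1q] := tangent_approx2 (re_part_sa w) e20.
have [T2 T2q] := tangent_approx2 (im_part_sa w) e20.
exists (T1 + 'i *: T2) => h; rewrite /form /= hdotDl hdotZl.
have -> : (e * rnorm h ^+ 2)%:C%C = (e / 2 * rnorm h ^+ 2)%:C%C + (e / 2 * rnorm h ^+ 2)%:C%C :> R[i].
  by rewrite -rmorphD -mulrDl -splitr.
rewrite opprD addrACA -mulrBr; apply: le_trans (ler_normD _ _) _.
by rewrite normrM normCi mul1r lerD.
Qed.

Lemma form_sa h u : star u = u -> form h u = (D h u)%:C%C.
Proof.
move=> su; rewrite /form re_part_id // im_part_eq0 // col_tangent0.
by rewrite mulr0 addr0.
Qed.

Lemma form_linear_map : exists Phi : {linear B -> bop H},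
  forall w h, hdot (Phi w h) h = form h w.
Proof.
have [F Fq] := choice form_operator.
have Fl : linear F.
  move=> c v w; apply: bop_ext => h.
  by rewrite -Fq form_linear /= hdotDl hdotZl -!Fq.
pose G := HB.pack_for {linear B -> bop H} F (GRing.isLinear.Build R[i] B (bop H) *:%R F Fl).
by exists G => w h; rewrite -Fq.
Qed.

Lemma col_tangent_colsq h a : colval rho h a <= D h (colsq a).
Proof.
apply: tangent_sq.
- exact: colsq1.
- exact: colsq_psd.
- exact: colval_ge0.
- exact: cdom.
- exact: colsq_dense.
Qed.

Lemma col_tangent_rowsq h a : rowval rho h a <= D h (rowsq a).
Proof.
have [<- _] := col_tangent_eq_row h (proj1 (rowsq_psd a)).
apply: tangent_sq.
- exact: rowsq1.
- exact: rowsq_psd.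
- exact: rowval_ge0.
- exact: rdom.
- exact: rowsq_dense.
Qed.

Lemma col_tangent_psd h u : psd u -> 0 <= D h u.
Proof.
move=> pu; apply: tangent_ge0 => //.
- exact: colsq1.
- exact: cdom.
Qed.

Lemma col_tangent1 h : D h 1 = rnorm h ^+ 2.
Proof.
apply: le_anti; apply/andP; split.
  by have := col_tangent_le h (star1 B); rewrite nrm1 mul1r.
by have := col_tangent_colsq h 1; rewrite colsq1 colval1.
Qed.

(** Comparing D_h(b^* b) >= |rho(b) h|^2 for b = 1 + t a with its expansion in t:
    the constant terms agree, so the coefficients of t agree as well. *)
Lemma col_tangent_re h a : D h (re_part (val a)) = complex.Re (hdot (rho a h) h).
Proof.
apply/eqP; rewrite -subr_eq0; apply/eqP.
apply: (@slope_eq0 _ _ (D h (colsq a) - colval rho h a)) => t.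
have := col_tangent_colsq h (1 + t *r a).
have -> : colsq (1 + t *r a) = 1 + ((2 * t) *r re_part (val a) + (t ^+ 2) *r colsq a).
  have -> : colsq (1 + t *r a) = star (1 + t *r val a) * (1 + t *r val a).
    by rewrite /colsq rmorphD /= linearZ /= rmorph1.
  rewrite /colsq /re_part starD star1 star_rsc.
  rewrite mulrDl !mulrDr !rscMl !rscMr !mulr1 !mul1r.
  by linear_identity; field.
have lin3 (p q : B) (x y : R) : star p = p -> star q = q ->
    D h (1 + (x *r p + y *r q)) = rnorm h ^+ 2 + (x * D h p + y * D h q).
  move=> sp sq.
  have sxp : star (x *r p) = x *r p by rewrite star_rsc sp.
  have syq : star (y *r q) = y *r q by rewrite star_rsc sq.
  by rewrite col_tangentD ?star1 // ?starD ?sxp ?syq // col_tangentD // !col_tangentZ // col_tangent1.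
rewrite lin3 ?re_part_sa //; last exact: (proj1 (colsq_psd a)).
have -> : colval rho h (1 + t *r a) =
    rnorm h ^+ 2 + 2 * t * complex.Re (hdot (rho a h) h) + t ^+ 2 * colval rho h a.
  rewrite /colval; have -> : rho (1 + t *r a) h = h + t *r rho a h.
    by rewrite (rmorphD rho) (rmorph1 rho) -rho_rsc.
  exact: rnorm_sqD.
lra.
Qed.

Lemma form_val h a : form h (val a) = hdot (rho a h) h.
Proof.
rewrite [RHS]complex_parts /form col_tangent_re; congr (_ + _ * _%:C%C).
rewrite /im_part -linearZ col_tangent_re linearZ /= hdotZl.
by case: (hdot (rho a h) h) => p q; rewrite /= !(mul0r, mulN1r, oppr0, sub0r, opprK).
Qed.

Lemma schwarz_extension_exists : exists Phi : {linear B -> bop H},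
  schwarz_extension rho Phi /\ forall w h, hdot (Phi w h) h = form h w.
Proof.
have [Phi Phif] := form_linear_map; exists Phi; split=> //; split.
- move=> b /psd_cstar_pos pb h; rewrite Phif form_sa; last by case: pb.
  by rewrite ler0c col_tangent_psd.
- by move=> a; apply: bop_ext => h; rewrite Phif form_val.
- move=> a h; rewrite /= hdotDl hdotNl Phif form_sa; last exact: (proj1 (colsq_psd a)).
  rewrite hdotC -adjointE -hdotC hdotE -rmorphB ler0c subr_ge0.
  exact: col_tangent_colsq.
- move=> a h; rewrite /= hdotDl hdotNl Phif form_sa; last exact: (proj1 (rowsq_psd a)).
  rewrite adjointE hdotE -rmorphB ler0c subr_ge0.
  exact: col_tangent_rowsq.
Qed.

(** If m a^* a <= s + u then m |rho(a) h|^2 <= s |h|^2 + <Phi(u) h, h>, so D_h(u) is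
    at most <Phi(u) h, h>. The same holds for -u, and both sides are odd. *)
Lemma schwarz_extension_form (Phi : {linear B -> bop H}) :
  positive_map Phi -> (forall a, Phi (val a) = rho a) ->
  (forall a, bop_le (adjoint (rho a) * rho a) (Phi (star (val a) * val a))) ->
  forall w h, hdot (Phi w h) h = form h w.
Proof.
move=> Phi_pos Phi_val Phi_sq w h.
pose phi v : R[i] := hdot (Phi v h) h.
have phiP (c : R[i]) u v : phi (c *: u + v) = c * phi u + phi v.
  by rewrite /phi linearP /= hdotDl hdotZl.
have phi0 : phi 0 = 0 by rewrite /phi linear0 /= hdot0l.
have phiZ (c : R[i]) u : phi (c *: u) = c * phi u by rewrite -[c *: u]addr0 phiP phi0 addr0.
have phiD u v : phi (u + v) = phi u + phi v by rewrite -{1}[u]scale1r phiP mul1r.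
have phiN u : phi (- u) = - phi u by rewrite -scaleN1r phiZ mulN1r.
have phi1 : phi 1 = (rnorm h ^+ 2)%:C%C.
  by have := Phi_val 1; rewrite !rmorph1 /phi => ->; rewrite hdotE.
have phi_psd v : psd v -> 0 <= phi v.
  by move=> /psd_cstar_pos /Phi_pos; apply.
have phi_real u : star u = u -> (complex.Re (phi u))%:C%C = phi u.
  by move=> su; apply: RRe_real; exact: positive_map_real.
have phi_ge u : star u = u -> D h u <= complex.Re (phi u).
  move=> su; apply: ge_sup; first exact: minorants_neq0.
  move=> _ [s [m [a [us m0 le ->]]]].
  rewrite colval1 lerBlDl; have sq_le : (colval rho h a)%:C%C <= phi (colsq a).
    have := Phi_sq a h; rewrite /= hdotDl hdotNl subr_ge0; apply: le_trans.
    by rewrite hdotC -adjointE -hdotC hdotE.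
  have := phi_psd _ le; rewrite !phiD phiN !phiZ phi1 subr_ge0.
  rewrite -(phi_real _ su) => le2.
  rewrite -lecR rmorphD (rmorphM _ m) (rmorphM _ s) /=; apply: le_trans le2.
  by rewrite ler_wpM2l // ler0c.
have phi_eq u : star u = u -> phi u = (D h u)%:C%C.
  move=> su; rewrite -(phi_real _ su); congr (_%:C%C); apply: le_anti.
  rewrite (phi_ge _ su) andbT; have sNu : star (- u) = - u by rewrite starN su.
  have [_ DN] := col_tangent_eq_row h su; have := phi_ge _ sNu; rewrite DN.
  rewrite phiN.
  by case: (phi u) => p q /=; rewrite lerN2.
rewrite -/(phi w) /form -!phi_eq ?re_part_sa ?im_part_sa // -phiZ -phiD; congr phi.
exact: cartesian.
Qed.

End Extension.

Theorem theorem4p6 (R : realType) (B : unitalCstar R)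
    (S : pred B) (A : subAlgType S) (hA : logmodular A)
    (H : hilbertType R) (rho : {lrmorphism A -> bop H})
    (rhoR : R_contractive 2 rho) (rhoC : C_contractive 2 rho) :
  exists Phi : {linear B -> bop H},
    [/\ schwarz_extension rho Phi,
        forall Phi' : {linear B -> bop H},
          schwarz_extension rho Phi' -> Phi' =1 Phi &
        forall Psi : {linear B -> bop H},
          completely_positive Psi -> (forall a : A, Psi (val a) = rho a) ->
          Psi =1 Phi].
Proof.
have [Phi [Phi_ext Phi_form]] := schwarz_extension_exists hA rhoR rhoC.
have unique (Phi' : {linear B -> bop H}) : positive_map Phi' ->
    (forall a, Phi' (val a) = rho a) ->
    (forall a, bop_le (adjoint (rho a) * rho a) (Phi' (star (val a) * val a))) ->
    Phi' =1 Phi.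
  move=> pos ext sq w; apply: bop_ext => h.
  by rewrite Phi_form (schwarz_extension_form hA rhoR rhoC pos ext sq).
exists Phi; split=> // [Phi' []|Psi cp ext]; first by move=> *; apply: unique.
have Psi1 : Psi 1 = 1 by have := ext 1; rewrite !rmorph1.
apply: unique => // [|a]; first exact: completely_positive_positive.
by have := completely_positive_schwarz cp Psi1 (val a); rewrite ext.
Qed.
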